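(* Let $K$ be an infinite field, let $\Delta$ be the specific simplicial complex on $\{1,\ldots,15\}$ defined in the context, let $\Delta^e$ be its exterior algebraic shifted complex (over $K$), and let $\mathcal{W}_{\mathrm{shift}}(\Delta)$ be the set of combinatorial shifted complexes of $\Delta$. Then there is no $\Delta^c\in\mathcal{W}_{\mathrm{shift}}(\Delta)$ with $\Delta^e=\Delta^c$.
   Context: Let $n=15$ and $[n]=\{1,\ldots,n\}$. A simplicial complex $\Delta$ on $[n]$ is a collection of subsets of $[n]$ containing all $\{j\}$, $j\in[n]$, and closed under taking subsets. $\Delta$ is shifted if for each $\sigma\in\Delta$ and $i\in\sigma$ one has $(\sigma\setminus\{i\})\cup\{j\}\in\Delta$ for all $j>i$ with $j\notin\sigma$. For $1\le i<j\le n$, $\mathrm{Shift}_{ij}(\Delta)$ is the simplicial complex whose faces are the sets $C_{ij}(\sigma)$, $\sigma\in\Delta$, where $C_{ij}(\sigma)=(\sigma\setminus\{i\})\cup\{j\}$ if $i\in\sigma$, $j\notin\sigma$ and $(\sigma\setminus\{i\})\cup\{j\}\notin\Delta$, and $C_{ij}(\sigma)=\sigma$ otherwise. A combinatorial shifted complex of $\Delta$ is any shifted complex of the form $\mathrm{Shift}_{i_qj_q}(\cdots(\mathrm{Shift}_{i_1j_1}(\Delta))\cdots)$ for a finite sequence of pairs $i_k<j_k$ in $[n]$. Let $V$ be a $K$-vector space with basis $e_1,\ldots,e_{15}$ and $E=\bigoplus_{d=0}^{15}\bigwedge^d(V)$. For $\sigma=\{j_1<\cdots<j_d\}$ put $e_\sigma=e_{j_1}\wedge\cdots\wedge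 e_{j_d}$. The exterior face ideal $J_\Delta\subset E$ is generated by the $e_\sigma$ with $\sigma\notin\Delta$; every monomial ideal of $E$ containing no $e_i$ is $J_\Delta$ for a unique $\Delta$. Let $<_{\mathrm{rev}}$ be the reverse lexicographic order on $E$ induced by $e_1>\cdots>e_n$ (for $|\sigma|=|\tau|$, $\sigma\neq\tau$: $e_\tau<_{\mathrm{rev}}e_\sigma$ iff the largest element of the symmetric difference of $\sigma$ and $\tau$ belongs to $\tau$). $GL(n;K)$ acts linearly on $V$ and hence on $E$ by algebra automorphisms. For a homogeneous ideal $I\subset E$, the generic initial ideal $\mathrm{Gin}^E(I)$ is the common value of $\mathrm{in}_{<_{\mathrm{rev}}}(\varphi(I))$ for $\varphi$ in a suitable nonempty Zariski open subset of $GL(n;K)$. $\Delta^e$ is the simplicial complex on $[n]$ with $J_{\Delta^e}=\mathrm{Gin}^E(J_\Delta)$. Construction of $\Delta$. Let $<_{\mathrm{lex}}$ be the lexicographic order on monomials of $E$ induced by $e_1>\cdots>e_{15}$. Put $h_1=e_1$, $h_2=e_2\wedge e_3$, $h_3=e_3\wedge e_4\wedge e_5$, $h_4=e_4\wedge\cdots\wedge e_7$, $h_5=e_5\wedge\cdots\wedge e_9$, $h_6=e_6\wedge\cdots\wedge e_{11}$. Define subsets of $\bigwedge^2(V)$: $H_3=\{e_{12}\wedge e_{13},\,e_{12}\wedge e_{15},\,e_{13}\wedge e_{14}\}$, $H_4=\{e_{12}\wedge e_{13},\,e_{12}\wedge e_{14},\,e_{14}\wedge e_{15}\}$, $H_5=\{e_{12}\wedge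 e_{13},\,e_{12}\wedge e_{15},\,e_{14}\wedge e_{15}\}$, $H_6=\{e_{12}\wedge e_{13},\,e_{13}\wedge e_{14},\,e_{14}\wedge e_{15}\}$, $H_7=\{e_{12}\wedge e_{13},\,e_{13}\wedge e_{15},\,e_{14}\wedge e_{15}\}$, $H_8=\{e_{12}\wedge e_{14},\,e_{13}\wedge e_{15},\,e_{14}\wedge e_{15}\}$. For $3\le i\le 8$ let $T_i=\{e_\sigma\in\bigwedge^i(V): h_{i-2}\wedge e_{12}\wedge e_{13}<_{\mathrm{lex}}e_\sigma\}$ and $T_i(H_i)=\{h_{i-2}\wedge e_\sigma: e_\sigma\in H_i\}$. Let $I\subset E$ be the ideal generated by the monomials in $\bigcup_{i=3}^8(T_i\cup T_i(H_i))$ together with all monomials of degree $9$. Then $\Delta$ is the simplicial complex on $\{1,\ldots,15\}$ with $I=J_\Delta$. *)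

(* Defs.v *)
From HB Require Import structures.
From Stdlib Require Import ClassicalEpsilon.
From mathcomp Require Import all_boot all_order all_algebra.
From mathcomp Require Import mpoly.

Set Implicit Arguments.
Unset Strict Implicit.
Unset Printing Implicit Defensive.

Import GRing.Theory.
Local Open Scope ring_scope.

(** * Exterior algebra *)

(* The vector e_j of the mathematics, 1 <= j <= n, is indexed by the ordinal
   j - 1 of 'I_n. An element of the exterior algebra is its family of
   coordinates in the basis (e_s), s ranging over the subsets of 'I_n. *)
Definition ext (K : fieldType) (n : nat) : Type := {ffun {set 'I_n} -> K^o}.

HB.instance Definition _ (K : fieldType) (n : nat) :=
  Vector.copy (ext K n) {ffun {set 'I_n} -> K^o}.

Section ExteriorAlgebra.
Variables (K : fieldType) (n : nat).
Implicit Types (s t u : {set 'I_n}) (f g h : ext K n).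

Definition mono s : ext K n := [ffun t => (t == s)%:R : K^o].

Definition inversions s t : nat := \sum_(i in s) \sum_(j in t) (j < i)%N.

Definition wedge_mono s t : ext K n :=
  if [disjoint s & t] then (-1) ^+ inversions s t *: mono (s :|: t) else 0.

Definition wedge f g : ext K n :=
  \sum_s \sum_t (f s * g t : K) *: wedge_mono s t.

Lemma extE f : f = \sum_s f s *: mono s.
Proof.
apply/ffunP => t; rewrite sum_ffunE (bigD1 t) //= big1 => [|s nst].
  by rewrite addr0 !ffunE eqxx; apply/esym/mulr1.
by rewrite !ffunE eq_sym (negPf nst); apply: mulr0.
Qed.

Lemma wedge_linl g : linear (wedge^~ g).
Proof.
move=> a f f'; rewrite /wedge scaler_sumr -big_split; apply: eq_bigr => s _ /=.
rewrite scaler_sumr -big_split; apply: eq_bigr => t _ /=.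
by rewrite !ffunE scalerA -scalerDl mulrA -mulrDl.
Qed.

Lemma wedge_linr f : linear (wedge f).
Proof.
move=> a g g'; rewrite /wedge scaler_sumr -big_split; apply: eq_bigr => s _ /=.
rewrite scaler_sumr -big_split; apply: eq_bigr => t _ /=.
by rewrite !ffunE scalerA -scalerDl mulrDr mulrCA.
Qed.

Lemma wedge_monoE s t : wedge (mono s) (mono t) = wedge_mono s t.
Proof.
rewrite /wedge (bigD1 s) //= (bigD1 t) //= !ffunE !eqxx mulr1 scale1r.
rewrite [X in _ + X + _]big1 => [|t' nt]; last first.
  by rewrite !ffunE (negPf nt) mulr0 scale0r.
rewrite big1 ?addr0 // => s' ns; rewrite big1 // => t' _.
by rewrite !ffunE (negPf ns) mul0r scale0r.
Qed.

Definition wedger g f := wedge f g.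
HB.instance Definition _ g := GRing.isLinear.Build K (ext K n)
  (ext K n) *:%R (wedger g) (wedge_linl g).
HB.instance Definition _ f := GRing.isLinear.Build K (ext K n)
  (ext K n) *:%R (wedge f) (wedge_linr f).

Lemma inversionsUl s t u : [disjoint s & t] ->
  inversions (s :|: t) u = (inversions s u + inversions t u)%N.
Proof.
move=> d; rewrite /inversions -bigU //; apply: eq_bigl => i.
by rewrite !inE.
Qed.

Lemma inversionsUr s t u : [disjoint t & u] ->
  inversions s (t :|: u) = (inversions s t + inversions s u)%N.
Proof.
move=> d; rewrite /inversions -big_split; apply: eq_bigr => i _ /=.
by rewrite -bigU //; apply: eq_bigl => j; rewrite !inE.
Qed.

Lemma wedge_monoA s t u :
  wedge (mono s) (wedge (mono t) (mono u)) =
  wedge (wedge (mono s) (mono t)) (mono u).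
Proof.
rewrite !wedge_monoE -[RHS]/(wedger _ _) {1 2}/wedge_mono.
case: ifP => dtu; last first.
  rewrite linear0; case: ifP => dst; last by rewrite linear0.
  rewrite linearZ /= /wedger wedge_monoE /wedge_mono -setI_eq0 setIUl setU_eq0.
  by rewrite !setI_eq0 dtu andbF scaler0.
rewrite linearZ /= wedge_monoE; case: ifP => dst; last first.
  rewrite linear0 /wedge_mono -setI_eq0 setIUr setU_eq0.
  by rewrite !setI_eq0 dst scaler0.
rewrite linearZ /= /wedger wedge_monoE /wedge_mono.
rewrite -!setI_eq0 setIUl setIUr !setU_eq0 !setI_eq0 dtu dst andbT /=.
case: ifP => dsu; last by rewrite !scaler0.
rewrite !scalerA -!exprD setUA inversionsUr // inversionsUl //.
by rewrite [X in _ ^+ X]addnC addnA.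
Qed.

Lemma wedge_suml (a : {set 'I_n} -> K) (x : {set 'I_n} -> ext K n) g :
  wedge (\sum_s a s *: x s) g = \sum_s a s *: wedge (x s) g.
Proof.
rewrite -[LHS]/(wedger g _) linear_sum.
by apply: eq_bigr => s _; rewrite linearZ.
Qed.

Lemma wedge_sumr (a : {set 'I_n} -> K) (x : {set 'I_n} -> ext K n) f :
  wedge f (\sum_s a s *: x s) = \sum_s a s *: wedge f (x s).
Proof. by rewrite linear_sum; apply: eq_bigr => s _; rewrite linearZ. Qed.

Lemma wedgeA : associative wedge.
Proof.
move=> f g h; rewrite (extE f) !wedge_suml; apply: eq_bigr => s _.
congr (_ *: _ : ext K n); rewrite (extE g) wedge_suml !wedge_sumr wedge_suml.
apply: eq_bigr => t _; congr (_ *: _ : ext K n).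
rewrite (extE h) !wedge_sumr; apply: eq_bigr => u _.
by rewrite wedge_monoA.
Qed.

Lemma wedge1f : left_id (mono set0) wedge.
Proof.
move=> f; rewrite [in LHS](extE f) [in RHS](extE f) wedge_sumr.
apply: eq_bigr => s _; rewrite wedge_monoE /wedge_mono.
by rewrite disjoints_subset sub0set /inversions big_set0 scale1r set0U.
Qed.

Lemma wedgef1 : right_id (mono set0) wedge.
Proof.
move=> f; rewrite [in LHS](extE f) [in RHS](extE f) wedge_suml.
apply: eq_bigr => s _; rewrite wedge_monoE /wedge_mono disjoint_sym disjoints_subset sub0set.
rewrite /inversions big1 => [|i _]; last by rewrite big_set0.
by rewrite scale1r setU0.
Qed.

Lemma wedgeDl : left_distributive wedge +%R.
Proof. by move=> f g h; apply: (linearD (wedger h)). Qed.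

Lemma wedgeDr : right_distributive wedge +%R.
Proof. by move=> f g h; apply: linearD. Qed.

Lemma mono0_neq0 : mono set0 != 0.
Proof.
apply/eqP => /ffunP/(_ set0); rewrite !ffunE eqxx => /eqP.
by rewrite (negPf (oner_neq0 K)).
Qed.

HB.instance Definition _ := GRing.Zmodule_isNzRing.Build (ext K n)
  wedgeA wedge1f wedgef1 wedgeDl wedgeDr mono0_neq0.

Lemma scale_wedgel a f g : a *: (f * g) = a *: f * g.
Proof. by rewrite -[RHS]/(wedger _ _) linearZ. Qed.

Lemma scale_wedger a f g : a *: (f * g) = f * (a *: g).
Proof. by rewrite -[RHS]/(wedge _ _) linearZ. Qed.

HB.instance Definition _ :=
  GRing.Lmodule_isLalgebra.Build K (ext K n) scale_wedgel.
HB.instance Definition _ :=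
  GRing.Lalgebra_isAlgebra.Build K (ext K n) scale_wedger.

Definition gen (i : 'I_n) : ext K n := mono [set i].

Lemma gen_sq i : gen i * gen i = 0.
Proof.
rewrite -[LHS]/(wedge _ _) wedge_monoE /wedge_mono.
by rewrite disjoints_subset sub1set !inE eqxx.
Qed.

Lemma gen_anticomm i j : gen i * gen j = - (gen j * gen i).
Proof.
have [->|nij] := eqVneq i j; first by rewrite gen_sq oppr0.
rewrite -[LHS]/(wedge _ _) -[X in - X]/(wedge _ _) !wedge_monoE /wedge_mono.
rewrite !disjoints_subset !sub1set !inE [j == i]eq_sym nij setUC -scaleNr /inversions.
rewrite !big_set1; congr (_ *: _).
by move: nij; rewrite -val_eqE /=; case: ltngtP; rewrite //= ?expr1 ?expr0 ?opprK.
Qed.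

(* enum s is increasing: this is e_s = e_{j_1} /\ ... /\ e_{j_d} with
   j_1 < ... < j_d. *)
Lemma mono_prod s : mono s = \prod_(i <- enum s) gen i.
Proof.
have srt : sorted (fun i j : 'I_n => i < j)%N (enum s).
  rewrite {1}/enum_mem; apply: sorted_filter.
    by move=> j i k; apply: ltn_trans.
  by have := iota_ltn_sorted 0 n; rewrite -val_enum_ord sorted_map enumT.
rewrite -[in LHS](set_enum s); elim: (enum s) srt => [|i l IHl] srt.
  by rewrite big_nil; congr mono; apply/setP => j; rewrite !inE.
have ltl j : j \in l -> (i < j)%N.
  by move: srt; rewrite /= path_sortedE => [|a b c]; [case/andP => /allP/(_ j)|apply: ltn_trans].
rewrite big_cons -IHl; last exact: path_sorted srt.
rewrite -[RHS]/(wedge _ _) wedge_monoE /wedge_mono disjoints_subset sub1set.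
rewrite !inE; have /negPf -> /= : i \notin l by apply/negP => /ltl; rewrite ltnn.
rewrite /inversions big_set1 big1 => [|j]; last first.
  by rewrite inE => /ltl lij; rewrite ltnNge ltnW.
by rewrite scale1r; congr mono; apply/setP => j; rewrite !inE.
Qed.
End ExteriorAlgebra.

(** * Ideals *)

Section Ideals.
Variables (K : fieldType) (n : nat).
Implicit Types (I S : ext K n -> Prop) (D : {set {set 'I_n}}).

Record is_ideal I : Prop := IsIdeal {
  ideal0 : I 0;
  idealD : forall f g, I f -> I g -> I (f + g);
  idealMl : forall f g, I g -> I (f * g);
  idealMr : forall f g, I f -> I (f * g)
}.

Definition ideal_gen S : ext K n -> Prop :=
  fun f => forall I, is_ideal I -> (forall g, S g -> I g) -> I f.

Lemma ideal_genP S : is_ideal (ideal_gen S).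
Proof.
split=> [I idI _|f g Sf Sg I idI SI|f g Sg I idI SI|f g Sf I idI SI].
- exact: ideal0.
- by apply: idealD => //; [apply: Sf|apply: Sg].
- by apply: idealMl => //; apply: Sg.
- by apply: idealMr => //; apply: Sf.
Qed.

Definition monomial_ideal D : ext K n -> Prop :=
  ideal_gen (fun f => exists2 s, s \in D & f = mono K s).

Lemma mul_supp (f g : ext K n) r : (f * g) r != 0 ->
  exists s t, [/\ f s != 0, g t != 0 & s :|: t = r].
Proof.
have [/existsP[s /existsP[t /and3P[fs gt /eqP str]]] _|] := boolP
  [exists s, [exists t, [&& f s != 0, g t != 0 & s :|: t == r]]].
  by exists s, t.
rewrite negb_exists => /forallP nst /eqP[]; rewrite -[f * g]/(wedge _ _).
rewrite sum_ffunE big1 // => s _; rewrite sum_ffunE big1 // => t _.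
have := nst s; rewrite negb_exists => /forallP/(_ t).
rewrite !ffunE /wedge_mono; have [->|_] := eqVneq (f s) 0.
  by rewrite mul0r scale0r.
have [->|_] := eqVneq (g t) 0; first by rewrite mulr0 scale0r.
case: ifP => _; last by rewrite ffunE scaler0.
by rewrite !ffunE => /= /negPf; rewrite eq_sym => ->; rewrite !scaler0.
Qed.

Lemma mono_monomial_ideal D s :
  monomial_ideal D (mono K s) <-> exists2 t, t \in D & t \subset s.
Proof.
split=> [|[t tD ts]]; last first.
  move=> I idI DI; have It : I (mono K t) by apply: DI; exists t.
  have {}It := idealMr idI (mono K (s :\: t)) It.
  have := idealMr idI ((-1) ^+ inversions t (s :\: t) *: 1) It.
  have -> : mono K t * mono K (s :\: t) =
      (-1) ^+ inversions t (s :\: t) *: mono K s.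
    rewrite -[LHS]/(wedge _ _) wedge_monoE /wedge_mono disjoint_sym.
    rewrite -setI_eq0 setIDAC setDIl setDv setI0 eqxx.
    congr (_ *: mono _ _); apply/setP => x; rewrite !inE.
    by case: (boolP (x \in t)) => // /(subsetP ts) ->.
  by rewrite -scalerAr mulr1 scalerA -expr2 sqrr_sign scale1r.
pose J (f : ext K n) := forall s, f s != 0 -> exists2 t, t \in D & t \subset s.
move=> sD; have: J (mono K s); last first.
  by apply; rewrite ffunE eqxx oner_neq0.
apply: sD => [|_ [t tD ->] r]; last first.
  rewrite ffunE; have [-> _|_] := eqVneq r t; last by rewrite eqxx.
  by exists t.
split=> [r|f g Jf Jg r|f g Jg r|f g Jf r].
- by rewrite ffunE eqxx.
- rewrite ffunE; have [->|/Jf//] := eqVneq (f r) 0.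
  by rewrite add0r => /Jg.
- move=> /mul_supp[u [v [_ /Jg[t tD tv] <-]]]; exists t => //.
  exact: subset_trans tv (subsetUr _ _).
- move=> /mul_supp[u [v [/Jf[t tD tu] _ <-]]]; exists t => //.
  exact: subset_trans tu (subsetUl _ _).
Qed.

Lemma monomial_idealS D1 D2 (f : ext K n) :
    (forall s, s \in D1 -> exists2 t, t \in D2 & t \subset s) ->
  monomial_ideal D1 f -> monomial_ideal D2 f.
Proof.
move=> D12; apply=> [|_ [s /D12 sD2 ->]]; first exact: ideal_genP.
exact/mono_monomial_ideal.
Qed.

Definition simplicial_complex D : Prop :=
  (forall j, [set j] \in D) /\
  (forall s t : {set 'I_n}, s \in D -> t \subset s -> t \in D).

Definition face_ideal D : ext K n -> Prop := monomial_ideal (~: D).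

(** * Generic initial ideals *)

Definition rev_lt (t s : {set 'I_n}) : bool :=
  (#|t| == #|s|) &&
  [exists k in t :\: s, forall l in (s :\: t) :|: (t :\: s), (l <= k)%N].

Definition lex_lt (t s : {set 'I_n}) : bool :=
  (#|t| == #|s|) &&
  [exists k in s :\: t, forall l in (s :\: t) :|: (t :\: s), (k <= l)%N].

(* rev_lt only compares monomials of the same degree, so only (nonzero)
   homogeneous elements have an initial monomial. *)
Definition initial_mono (f : ext K n) (s : {set 'I_n}) : Prop :=
  f s != 0 /\ (forall t, f t != 0 -> t != s -> rev_lt t s).

(* Meant for homogeneous I, whose initial ideal is generated by the initial
   monomials of its homogeneous elements. *)
Definition initial_ideal I : ext K n -> Prop :=
  ideal_gen (fun g =>
    exists f s, [/\ I f, initial_mono f s & g = mono K s]).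

(* The algebra endomorphism sending e_j to \sum_i A i j e_i. *)
Definition gl_act (A : 'M[K]_n) (f : ext K n) : ext K n :=
  \sum_s f s *: \prod_(j <- enum s) \sum_i A i j *: gen K i.

Definition gl_image (A : 'M[K]_n) I : ext K n -> Prop :=
  fun g => exists2 f, I f & g = gl_act A f.

Definition zariski_open_GL (U : 'M[K]_n -> Prop) : Prop :=
  exists P : {mpoly K[n * n]} -> Prop, forall A,
    U A <-> A \in unitmx /\ exists2 p, P p & p.@[mxvec A 0] != 0.

Definition is_gin I (G : ext K n -> Prop) : Prop :=
  exists U : 'M[K]_n -> Prop,
    [/\ zariski_open_GL U, exists A, U A &
        forall A, U A -> forall f, initial_ideal (gl_image A I) f <-> G f].

End Ideals.

Arguments monomial_ideal K {n} D f.
Arguments face_ideal K {n} D f.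

(** * Algebraic and combinatorial shifting *)

(* A definite description: when K is infinite and D is a simplicial complex,
   there is exactly one De with the stated property. *)
Definition exterior_shift (K : fieldType) (n : nat) (D : {set {set 'I_n}}) :
    {set {set 'I_n}} :=
  epsilon (inhabits set0) (fun De : {set {set 'I_n}} =>
    simplicial_complex De /\ is_gin (face_ideal K D) (face_ideal K De)).

Section CombinatorialShifting.
Variable n : nat.
Implicit Types (D : {set {set 'I_n}}) (s : {set 'I_n}).

Definition shifted D : Prop :=
  forall s (i j : 'I_n), s \in D -> i \in s -> (i < j)%N -> j \notin s ->
    j |: (s :\ i) \in D.

Definition shift_face D (i j : 'I_n) s : {set 'I_n} :=
  if [&& i \in s, j \notin s & j |: (s :\ i) \notin D] then j |: (s :\ i)
  else s.

Definition shift D (i j : 'I_n) : {set {set 'I_n}} :=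
  [set shift_face D i j s | s in D].

Definition combinatorial_shift D Dc : Prop :=
  shifted Dc /\
  exists p : seq ('I_n * 'I_n), all (fun ij : 'I_n * 'I_n => ij.1 < ij.2)%N p /\
    Dc = foldl (fun D' (ij : 'I_n * 'I_n) => shift D' ij.1 ij.2) D p.

End CombinatorialShifting.

(** * The complex on 15 vertices *)

(* vertices [:: k_1; ...; k_d] is the set of the indices of e_(k_1), ...,
   e_(k_d), where the k's count from 1. *)
Definition vertices (l : seq nat) : {set 'I_15} := [set i : 'I_15 | i.+1 \in l].

Definition h15 (k : nat) : {set 'I_15} :=
  match k with
  | 1 => vertices [:: 1]
  | 2 => vertices [:: 2; 3]
  | 3 => vertices [:: 3; 4; 5]
  | 4 => vertices [:: 4; 5; 6; 7]
  | 5 => vertices [:: 5; 6; 7; 8; 9]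
  | 6 => vertices [:: 6; 7; 8; 9; 10; 11]
  | _ => set0
  end%N.

Definition H15 (i : nat) : {set {set 'I_15}} :=
  match i with
  | 3 => [set vertices [:: 12; 13]; vertices [:: 12; 15]; vertices [:: 13; 14]]
  | 4 => [set vertices [:: 12; 13]; vertices [:: 12; 14]; vertices [:: 14; 15]]
  | 5 => [set vertices [:: 12; 13]; vertices [:: 12; 15]; vertices [:: 14; 15]]
  | 6 => [set vertices [:: 12; 13]; vertices [:: 13; 14]; vertices [:: 14; 15]]
  | 7 => [set vertices [:: 12; 13]; vertices [:: 13; 15]; vertices [:: 14; 15]]
  | 8 => [set vertices [:: 12; 14]; vertices [:: 13; 15]; vertices [:: 14; 15]]
  | _ => set0
  end%N.

Definition T15 (i : nat) : {set {set 'I_15}} :=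
  [set s : {set 'I_15} |
    #|s| == i & lex_lt (h15 (i - 2) :|: vertices [:: 12; 13]%N) s].

(* All elements of h15 (i - 2) are smaller than 12, so h_(i-2) /\ e_s is the
   monomial of the union, with sign +1. *)
Definition TH15 (i : nat) : {set {set 'I_15}} :=
  [set h15 (i - 2) :|: s | s : {set 'I_15} in H15 i].

Definition gens15 : {set {set 'I_15}} :=
  (\bigcup_(3 <= i < 9) (T15 i :|: TH15 i)) :|:
  [set s : {set 'I_15} | #|s| == 9%N].

Definition ideal15 (K : fieldType) : ext K 15 -> Prop :=
  monomial_ideal K gens15.
Arguments ideal15 K f : clear implicits.

Definition Delta15 : {set {set 'I_15}} :=
  [set s : {set 'I_15} | ~~ [exists t : {set 'I_15} in gens15, t \subset s]].

Lemma card_vertices l :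
  #|vertices l| = \sum_(i < 15) (i.+1 \in l : nat).
Proof.
rewrite -sum1_card big_mkcond; apply: eq_bigr => i _.
by rewrite inE; case: ifP.
Qed.

Lemma gens15_card t : t \in gens15 -> (2 < #|t|)%N.
Proof.
rewrite /gens15 inE => /orP[|]; last by rewrite inE => /eqP ->.
have vU l m : vertices l :|: vertices m = vertices (l ++ m).
  by apply/setP => i; rewrite !inE mem_cat.
rewrite big_nat; elim/big_ind: _ => [|A B IA IB|i /andP[i3 i9]].
- by rewrite inE.
- by rewrite inE => /orP[].
rewrite inE => /orP[|]; first by rewrite inE => /andP[/eqP ->].
case/imsetP => s sH -> {t}.
case: i i3 i9 sH => [|[|[|[|[|[|[|[|[|i]]]]]]]]] //= _ _;
  rewrite !inE -?orbA => /or3P[] /eqP ->;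
  by rewrite vU card_vertices !big_ord_recl big_ord0.
Qed.

Lemma Delta15P (K : fieldType) (D : {set {set 'I_15}}) :
  (simplicial_complex D /\ forall f, face_ideal K D f <-> ideal15 K f) <->
  D = Delta15.
Proof.
split=> [[[_ Dsub] DI]|->].
  apply/setP => s; apply/idP/idP => [sD|].
    rewrite inE; apply/negP => /existsP[t /andP[tG ts]].
    have /DI/mono_monomial_ideal[u] : ideal15 K (mono K s).
      by apply/mono_monomial_ideal; exists t.
    by rewrite inE => /negP uD us; apply/uD/(Dsub s).
  apply: contraTT => sD; rewrite inE negbK.
  have /DI/mono_monomial_ideal[t tG ts] : face_ideal K D (mono K s).
    by apply/mono_monomial_ideal; exists s => //; rewrite inE.
  by apply/existsP; exists t; rewrite tG.
split; first split=> [j|s t].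
- rewrite inE; apply/negP => /existsP[t /andP[/gens15_card t2]].
  by move=> /subset_leq_card; rewrite cards1 leqNgt (ltnW t2).
- rewrite !inE => /negP sD ts; apply/negP => /existsP[u /andP[uG ut]].
  by apply/sD/existsP; exists u; rewrite uG (subset_trans ut).
move=> f; split; apply: monomial_idealS => s.
  rewrite !inE negbK => /existsP[t /andP[tG ts]]; by exists t.
by move=> sG; exists s => //; rewrite !inE negbK; apply/existsP; exists s; rewrite sG /=.
Qed.

(* Main.v *)
Require Import Defs.
From mathcomp Require Import all_boot all_algebra.
From HB Require Import structures.
From Stdlib Require Import ClassicalEpsilon.
From mathcomp Require Import mpoly zify ring.

Set Implicit Arguments.
Unset Strict Implicit.
Unset Printing Implicit Defensive.

Import GRing.Theory.

(** In each cardinality [k + 2], with [1 <= k <= 6], the nonfaces of [Delta15]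
    are a lexicographic initial segment together with three sets
    [h15 k :|: [set a; b]], where the pairs [{a, b}] are the edges of a path on
    the vertices 12, 13, 14, 15. The initial segments are stable under
    shifting, combinatorial as well as algebraic, so both shiftings only act
    on the six graphs. A shifted graph with three edges, written for nonfaces,
    is either the triangle on 12, 13, 14 or the star with centre 12, and the
    set [h15 k :|: [set 13; 14]] tells them apart: it is a nonface in the first
    case and a face in the second.

    Combinatorial shifting. A pair [i < j] with [i <= 11] does nothing to the
    six graphs. The paths are chosen so that each of the six pairs [i < j] in
    12, ..., 15 turns one of them into a star ([first_star]); a shift of a star
    is a star ([star_shift]), and the initial complex is not shifted. Hence
    every combinatorial shifted complex has a star at some level, that is, it
    has the face [h15 k :|: [set 13; 14]] for some [k]
    ([combinatorial_shift_face]).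

    Algebraic shifting. All six paths become the triangle. A generic matrix is
    a product [L U] of a lower and an upper triangular one ([generic_lu]), and
    [L] preserves initial monomials for the reverse lexicographic order
    ([lower_initial]), so that it suffices to look at upper triangular [U]
    ([generic_upper_gin]). These preserve the lexicographic initial segment;
    modulo it they map the three monomials of the path to combinations of the
    monomials [h15 k :|: [set a; b]]. The three-dimensional space so obtained
    projects onto the coordinates 12 13, 12 14 and 13 14 as soon as a 3 x 3
    determinant is nonzero; then it has an element with initial monomial
    [h15 k :|: [set 13; 14]] ([level_initial]). One shear makes the six
    determinants equal to 1 or -1 in every characteristic ([shear_det3]).

    Since [exterior_shift] is a description, the generic initial ideal also has
    to be shown to exist. Its monomials are governed by the ranks of
    finitely many matrices with polynomial entries, which are constant on a
    nonempty open set ([gin_exists]). *)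

(** * Lexicographic and reverse lexicographic orders *)

Section Orders.
Variable n : nat.
Implicit Types s t u : {set 'I_n}.

Lemma lex_ltP t s : reflect
  (#|t| = #|s| /\ exists k : 'I_n, [/\ k \in s, k \notin t &
     forall l : 'I_n, (l < k)%N -> (l \in t) = (l \in s)])
  (lex_lt t s).
Proof.
apply: (iffP andP) => [[/eqP c /existsP[k /andP[]]]|[c [k [ks kt kmin]]]].
  rewrite inE => /andP[kt ks] /forallP kmin; split=> //; exists k; split=> // l lk.
  have := kmin l; rewrite !inE leqNgt lk implybF.
  by case: (l \in t); case: (l \in s).
split; first exact/eqP; apply/existsP; exists k; rewrite inE ks kt /=.
apply/forallP => l; apply/implyP; apply: contraTT; rewrite -ltnNge !inE => /kmin ->.
by case: (l \in s).
Qed.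

Lemma rev_ltP t s : reflect
  (#|t| = #|s| /\ exists k : 'I_n, [/\ k \in t, k \notin s &
     forall l : 'I_n, (k < l)%N -> (l \in t) = (l \in s)])
  (rev_lt t s).
Proof.
apply: (iffP andP) => [[/eqP c /existsP[k /andP[]]]|[c [k [ks kt kmin]]]].
  rewrite inE => /andP[kt ks] /forallP kmin; split=> //; exists k; split=> // l lk.
  have := kmin l; rewrite !inE leqNgt lk implybF.
  by case: (l \in t); case: (l \in s).
split; first exact/eqP; apply/existsP; exists k; rewrite inE ks kt /=.
apply/forallP => l; apply/implyP; apply: contraTT; rewrite -ltnNge !inE => /kmin ->.
by case: (l \in s).
Qed.

Lemma rev_lt_irr s : rev_lt s s = false.
Proof. by apply/rev_ltP => -[_ [k [-> ]]]. Qed.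

Lemma lex_lt_trans : transitive (@lex_lt n).
Proof.
move=> s t u /lex_ltP[cts [k [ks kt tk]]] /lex_ltP[csu [l [lu ls sl]]].
apply/lex_ltP; split; first by rewrite cts.
case: (ltngtP k l) => [kl|lk|/val_inj kl]; last by rewrite -kl ks in ls.
- exists k; split=> // [|i ik]; first by rewrite -sl.
  by rewrite tk // sl // (ltn_trans ik).
- exists l; split=> // [|i il]; first by rewrite tk.
  by rewrite tk ?sl // (ltn_trans il).
Qed.

Lemma rev_lt_trans : transitive (@rev_lt n).
Proof.
move=> s t u /rev_ltP[cts [k [ks kt tk]]] /rev_ltP[csu [l [lu ls sl]]].
apply/rev_ltP; split; first by rewrite cts.
case: (ltngtP k l) => [kl|lk|/val_inj kl]; last by rewrite -kl (negPf kt) in lu.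
- exists l; split=> // [|i ik]; first by rewrite tk.
  by rewrite tk ?sl // (ltn_trans kl).
- exists k; split=> // [|i il]; first by rewrite -sl.
  by rewrite tk // sl // (ltn_trans lk).
Qed.

Lemma first_difference s t : s != t -> exists k : 'I_n,
  (k \in s) != (k \in t) /\ forall l : 'I_n, (l < k)%N -> (l \in s) = (l \in t).
Proof.
move=> nst; have [k0 k0P] : exists k, (k \in s) != (k \in t).
  apply/existsP; apply: contraNT nst; rewrite negb_exists => /forallP st.
  by apply/eqP/setP => k; apply/eqP; rewrite -[_ == _]negbK st.
pose D := [pred k : 'I_n | (k \in s) != (k \in t)].
have [k kP kmin] := @arg_minnP _ k0 D (fun k : 'I_n => k : nat) k0P.
exists k; split=> // l lk; apply/eqP; apply: contraTT lk => lP.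
by rewrite -leqNgt kmin.
Qed.

Lemma last_difference s t : s != t -> exists k : 'I_n,
  (k \in s) != (k \in t) /\ forall l : 'I_n, (k < l)%N -> (l \in s) = (l \in t).
Proof.
move=> nst; have [k0 [k0P _]] := first_difference nst.
pose D := [pred k : 'I_n | (k \in s) != (k \in t)].
have [k kP kmax] := @arg_maxnP _ k0 D (fun k : 'I_n => k : nat) k0P.
exists k; split=> // l lk; apply/eqP; apply: contraTT lk => lP.
by rewrite -leqNgt; apply: kmax.
Qed.

End Orders.

(** * Combinatorial shifting of set systems *)

Section Shift.
Variable n : nat.
Implicit Types (D : {set {set 'I_n}}) (s t : {set 'I_n}) (i j : 'I_n).

Lemma card_swap s i j : i \in s -> j \notin s -> #|j |: s :\ i| = #|s|.
Proof. by move=> si sj; rewrite cardsU1 !inE (negPf sj) andbF [RHS](cardsD1 i) si. Qed.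

Lemma swapK s i j : i \in s -> j \notin s -> i |: (j |: s :\ i) :\ j = s.
Proof.
move=> si sj; apply/setP => l; rewrite !inE; have [->|li] := eqVneq l i; first by rewrite si.
by have [->|] := eqVneq l j; first by rewrite (negPf sj).
Qed.

Lemma lex_lt_swap s i j : (i < j)%N -> i \in s -> j \notin s -> lex_lt (j |: s :\ i) s.
Proof.
move=> ij si sj; apply/lex_ltP; rewrite card_swap //; split=> //; exists i; split=> //.
  by rewrite !inE eqxx /= orbF; apply: contraTneq ij => ->; rewrite ltnn.
by move=> l li; rewrite !inE -!val_eqE /= (ltn_eqF li) (ltn_eqF (ltn_trans li ij)).
Qed.

(** Whether [t] survives a shift depends only on [t] and on the one set paired
    with it by exchanging [i] and [j]: of the two, the set that contains [j] is
    kept first. *)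
Lemma mem_shift D i j t : (i < j)%N -> (t \in shift D i j) =
  if i \in t then (t \in D) && ((j \in t) || (j |: t :\ i \in D))
  else (t \in D) || (j \in t) && (i |: t :\ j \in D).
Proof.
move=> ij; have nij : i != j by apply: contraTneq ij => ->; rewrite ltnn.
apply/imsetP/idP => [[s sD ->]|].
  rewrite /shift_face.
  have [/and3P[si sj sij]|] := boolP [&& i \in s, j \notin s & j |: s :\ i \notin D].
    by rewrite !inE eqxx (negPf nij) /= eqxx swapK // sD orbT.
  by rewrite !negb_and !negbK sD; case: (i \in s).
case: ifP => [it /andP[tD] | it].
  by move=> jt; exists t => //; rewrite /shift_face it -negb_or jt.
case/boolP: (t \in D) => [tD _|tD /= /andP[jt sD]].
  by exists t => //; rewrite /shift_face it.
exists (i |: t :\ j) => //; rewrite /shift_face swapK ?it // tD !inE eqxx /=.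
by rewrite (eq_sym j) (negPf nij) eqxx.
Qed.

End Shift.

(** * The complex in each cardinality *)

(** Vertices are counted from 1 in the names, and from 0 in ['I_15]. *)
Definition v12 : 'I_15 := @Ordinal 15 11 isT.
Definition v13 : 'I_15 := @Ordinal 15 12 isT.
Definition v14 : 'I_15 := @Ordinal 15 13 isT.
Definition v15 : 'I_15 := @Ordinal 15 14 isT.

Definition top4 (a : 'I_15) : bool := (11 <= a)%N.

Definition face (k : nat) (a b : 'I_15) : {set 'I_15} := h15 k :|: [set a; b].

(** The pairs of [H15 (k + 2)]. The index is the size [k] of the common part
    [h15 k], not the cardinality of the generators. *)
Definition Hpairs (k : nat) : seq ('I_15 * 'I_15) :=
  match k with
  | 1 => [:: (v12, v13); (v12, v15); (v13, v14)]
  | 2 => [:: (v12, v13); (v12, v14); (v14, v15)]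
  | 3 => [:: (v12, v13); (v12, v15); (v14, v15)]
  | 4 => [:: (v12, v13); (v13, v14); (v14, v15)]
  | 5 => [:: (v12, v13); (v13, v15); (v14, v15)]
  | 6 => [:: (v12, v14); (v13, v15); (v14, v15)]
  | _ => [::]
  end.

Lemma vertices2 (a b : 'I_15) : vertices [:: a.+1; b.+1] = [set a; b].
Proof. by apply/setP => i; rewrite !inE !eqSS. Qed.

Lemma top4P a : top4 a -> [\/ a = v12, a = v13, a = v14 | a = v15].
Proof.
case: a => m lt_m; rewrite /top4 /= => m11.
have : m \in [:: 11; 12; 13; 14] by rewrite !inE; lia.
rewrite !inE => /or4P[] /eqP e; [constructor 1|constructor 2|constructor 3|constructor 4]; exact: val_inj.
Qed.

Definition level k := (0 < k < 7)%N.

Lemma levelP k : level k -> k \in [:: 1; 2; 3; 4; 5; 6].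
Proof. by rewrite /level !inE; lia. Qed.

Lemma mem_h15 k (i : 'I_15) : level k -> (i \in h15 k) = (k <= i.+1 < k.*2)%N.
Proof.
move=> /levelP; rewrite !inE; case: i => m lt_m.
by move=> /or4P[|||/or3P[]] /eqP -> /=; rewrite !inE /=; lia.
Qed.

Lemma h15_top k a : level k -> top4 a -> a \notin h15 k.
Proof. by move=> lk; rewrite mem_h15 // /top4; move: lk; rewrite /level; lia. Qed.

Lemma card_h15 k : level k -> #|h15 k| = k.
Proof.
move=> /levelP; rewrite !inE.
by move=> /or4P[|||/or3P[]] /eqP -> /=; rewrite card_vertices !big_ord_recl big_ord0.
Qed.

Lemma mem_face k a b i : (i \in face k a b) = (i \in h15 k) || (i == a) || (i == b).
Proof. by rewrite !inE orbA. Qed.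

Lemma mem_face_low k a b (i : 'I_15) : top4 a -> top4 b -> (i < 11)%N ->
  (i \in face k a b) = (i \in h15 k).
Proof.
move=> a4 b4 i11; rewrite mem_face -!val_eqE /=.
by rewrite !ltn_eqF ?orbF // (leq_trans i11).
Qed.

Lemma mem_face_top k a b i : level k -> top4 i -> (i \in face k a b) = (i == a) || (i == b).
Proof. by move=> lk i4; rewrite mem_face (negPf (h15_top lk i4)). Qed.

Lemma faceC k a b : face k a b = face k b a.
Proof. by rewrite /face setUC [in RHS]setUC [in RHS](setUC [set b]). Qed.

Lemma card_face k a b : level k -> top4 a -> top4 b -> a != b -> #|face k a b| = k.+2.
Proof.
move=> lk a4 b4 ab; rewrite cardsU card_h15 // cards2 ab.
rewrite [_ :&: _](_ : _ = set0) ?cards0 ?subn0 ?addn2 //.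
apply/setP => i; rewrite !inE; apply/negP => /andP[ih /orP[]/eqP e].
  by move: (h15_top lk a4); rewrite -e ih.
by move: (h15_top lk b4); rewrite -e ih.
Qed.

Lemma face_inj k a b c d : level k -> top4 a -> top4 b -> top4 c -> top4 d ->
  face k a b = face k c d -> [set a; b] = [set c; d].
Proof.
move=> lk a4 b4 c4 d4 /setP e; apply/setP => i; have := e i; rewrite !inE.
case/boolP: (i \in h15 k) => //= ih _.
have ni x : top4 x -> (i == x) = false.
  by move=> x4; apply: contraTF ih => /eqP ->; apply: h15_top.
by rewrite !ni.
Qed.

Lemma face_swap k a b x : level k -> top4 a -> a != b -> x |: face k a b :\ a = face k x b.
Proof.
move=> lk a4 ab; apply/setP => i; rewrite in_setU1 in_setD1 !mem_face.
have [->|ia] := eqVneq i a; last by rewrite orbF orbCA orbA.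
by rewrite (negPf (h15_top lk a4)) (negPf ab) orbF.
Qed.

(** The faces [face k a b] form the interval from [face k v14 v15] to
    [face k v12 v13] in the lexicographic order of their cardinality; [high]
    and [low] are what lies on its two sides. *)
Definition high k : pred {set 'I_15} := lex_lt (face k v12 v13).
Definition low k s := lex_lt s (face k v14 v15).

(** Exchanging a vertex below 12 with a larger one takes a face out of the
    interval, to a side where membership is known: so the pairs [i < j] with
    [i] below 12 will have no effect on the interval. *)
Lemma high_swap k a b (i j : 'I_15) : level k -> top4 a -> top4 b -> a != b ->
  (i < 11)%N -> (i < j)%N -> i \notin face k a b -> j \in face k a b ->
  high k (i |: face k a b :\ j).
Proof.
move=> lk a4 b4 ab i11 ij iN jI; apply/lex_ltP; rewrite card_swap // !card_face //.
split=> //; exists i; split; first by rewrite !inE eqxx.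
  by move: iN; rewrite !mem_face_low.
move=> l li; rewrite in_setU1 in_setD1 !mem_face_low ?(ltn_trans li) //.
by rewrite -!val_eqE /= (ltn_eqF li) (ltn_eqF (ltn_trans li ij)).
Qed.

Lemma low_swap k a b (i j : 'I_15) : level k -> top4 a -> top4 b -> a != b ->
  (i < 11)%N -> (i < j)%N -> i \in face k a b -> j \notin face k a b ->
  low k (j |: face k a b :\ i).
Proof.
move=> lk a4 b4 ab i11 ij iI jN; apply/lex_ltP; rewrite card_swap // !card_face //.
split=> //; exists i; split; first by move: iI; rewrite !mem_face_low.
  by rewrite !inE eqxx /= orbF; apply: contraTneq ij => ->; rewrite ltnn.
move=> l li; rewrite in_setU1 in_setD1 !mem_face_low ?(ltn_trans li) //.
by rewrite -!val_eqE /= (ltn_eqF li) (ltn_eqF (ltn_trans li ij)).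
Qed.

(** Let [m] be the first element of [s] that is not in the face. If [m] is
    below 12 then [s] already beats all the faces; otherwise [s] agrees with
    [h15 k] below 12 and has two more elements. *)
Lemma above_face k a b s : level k -> top4 a -> top4 b -> a != b ->
  lex_lt (face k a b) s ->
  high k s \/ exists c d, [/\ top4 c, top4 d, c != d & s = face k c d].
Proof.
move=> lk a4 b4 ab /lex_ltP[cs [m [ms mN mlt]]].
have cards : #|s| = k.+2 by rewrite -cs card_face.
have [m11|m11] := ltnP m 11.
  left; apply/lex_ltP; rewrite card_face //; split=> //; exists m; split=> //.
    by move: mN; rewrite !mem_face_low.
  by move=> l lm; rewrite -mlt // !mem_face_low ?(ltn_trans lm).
right; have low_s (l : 'I_15) : (l < 11)%N -> (l \in s) = (l \in h15 k).
  by move=> l11; rewrite -mlt ?(leq_trans l11) // mem_face_low.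
have hs : h15 k \subset s.
  apply/subsetP => l lh; rewrite low_s //; apply: contraTT lh; rewrite -leqNgt.
  exact: h15_top.
have /cards2P[c [d [cd scd]]] : #|s :\: h15 k| == 2.
  by rewrite cardsD (setIidPr hs) cards card_h15 // -addn2 addKn.
have top x : x \in s :\: h15 k -> top4 x.
  by rewrite inE => /andP[xh xs]; rewrite /top4 leqNgt; apply: contra xh => /low_s <-.
exists c, d; split; [apply: top|apply: top| |]; rewrite ?scd ?inE ?eqxx ?orbT //.
by rewrite /face -scd setDE setUIr setUCr setIT; apply/esym/setUidPr.
Qed.

Lemma face_not_high k a b : level k -> top4 a -> top4 b -> ~~ high k (face k a b).
Proof.
move=> lk a4 b4; apply/negP => /lex_ltP[_ [m [mI mN mlt]]].
have m4 : top4 m.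
  by move: mI mN; rewrite !mem_face; case: (m \in h15 k) => //= /orP[]/eqP->.
have mem4 i := mem_face_top _ _ lk (i := i).
move: mN mI (mlt v12) (mlt v13); rewrite !mem4 //.
by case: (top4P a4) => ->; case: (top4P b4) => ->; case: (top4P m4) => -> //= _ _ H1 H2;
  first [by have := H1 isT | by have := H2 isT].
Qed.

Lemma face_not_low k a b : level k -> top4 a -> top4 b -> a != b -> ~~ low k (face k a b).
Proof.
move=> lk a4 b4 ab; apply/negP => /lex_ltP[_ [m [mI mN mlt]]].
have m4 : top4 m.
  by move: mI mN; rewrite !mem_face; case: (m \in h15 k) => //= /orP[]/eqP->.
have mem4 i := mem_face_top _ _ lk (i := i).
move: ab mN mI (mlt v12) (mlt v13) (mlt v14); rewrite !mem4 //.
by case: (top4P a4) => ->; case: (top4P b4) => ->; case: (top4P m4) => -> //= _ _ _ H1 H2 H3;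
  first [by have := H1 isT | by have := H2 isT | by have := H3 isT].
Qed.

Lemma mem_H15 k s : level k ->
  (s \in H15 (k + 2)) = (s \in [seq [set p.1; p.2] | p <- Hpairs k]).
Proof.
move=> /levelP; rewrite !inE.
by rewrite addn2 => /or4P[|||/or3P[]] /eqP -> /=; rewrite !inE -!vertices2 orbA.
Qed.

Lemma Hpairs_top k p : level k -> p \in Hpairs k -> [/\ top4 p.1, top4 p.2 & p.1 != p.2].
Proof.
move=> /levelP; rewrite !inE.
by move=> /or4P[|||/or3P[]] /eqP -> /=; rewrite !inE => /or3P[] /eqP ->.
Qed.

Lemma Hpairs_lt k p : level k -> p \in Hpairs k -> (p.1 < p.2)%N.
Proof.
move=> /levelP; rewrite !inE.
by move=> /or4P[|||/or3P[]] /eqP -> /=; rewrite !inE => /or3P[] /eqP ->.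
Qed.

Lemma T15E k s : level k -> (s \in T15 (k + 2)) = high k s.
Proof.
move=> lk; rewrite inE addnK /high -[vertices _]/(vertices [:: v12.+1; v13.+1]) vertices2.
rewrite -/(face k v12 v13); apply/andP/idP => [[]//|hs]; split=> //.
have [+ _] := lex_ltP _ _ hs; rewrite card_face //= => <-.
by rewrite addn2.
Qed.

Lemma mem_gens15 s : s \in gens15 <->
  #|s| = 9 \/ exists2 k, level k &
    high k s \/ exists2 p, p \in Hpairs k & s = face k p.1 p.2.
Proof.
have lowP s' : (s' \in \bigcup_(3 <= j < 9) (T15 j :|: TH15 j)) <->
    exists2 k, level k & s' \in T15 (k + 2) :|: TH15 (k + 2).
  rewrite big_nat; split=> [|[k lk sk]].
    elim/big_ind: _ => [|A B IA IB|j j39 sj]; first by rewrite inE.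
      by rewrite inE => /orP[].
    exists (j - 2); first by rewrite /level; lia.
    by rewrite subnK //; lia.
  have k39 : k + 2 \in index_iota 3 9 by rewrite mem_index_iota; move: lk; rewrite /level; lia.
  rewrite (big_rem _ k39) /= -mem_index_iota k39 inE sk; exact: orTb.
rewrite /gens15 inE [X in _ || X]inE.
have THP k : level k -> (s \in TH15 (k + 2)) <->
    exists2 p, p \in Hpairs k & s = face k p.1 p.2.
  move=> lk; rewrite /TH15 addnK; split=> [/imsetP[u + ->]|[p pH ->]].
    by rewrite mem_H15 // => /mapP[p pH ->]; exists p.
  apply/imsetP; exists [set p.1; p.2] => //; rewrite mem_H15 //; exact: map_f.
split=> [/orP[/lowP[k lk]|/eqP]|[s9|[k lk sk]]]; [|by left| |].
- rewrite inE T15E // => /orP[sk|/(THP _ lk) sk]; right; exists k => //; first by left.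
  by right.
- by rewrite s9 orbT.
- apply/orP; left; apply/lowP; exists k => //; rewrite inE T15E //.
  by case: sk => [->//|/(THP _ lk) ->]; rewrite orbT.
Qed.

(** The blocks [h15 k] start at [k], so a generator of level [k] has an
    element that is too small for the faces of all higher levels: generators
    of different levels do not interfere. Counted from 0, the least element of
    [h15 k] is [k - 1]. *)
Lemma gens15_small_element s : s \in gens15 -> #|s| = 9 \/
  exists k, [/\ level k, #|s| = k.+2, high k s \/ (exists2 p, p \in Hpairs k & s = face k p.1 p.2) &
    exists2 e : 'I_15, e \in s & (e < k)%N].
Proof.
move=> /mem_gens15[|[k lk sk]]; [by left|right; exists k].
have [k15 k0] : (k.-1 < 15 /\ 0 < k)%N by move: lk; rewrite /level; lia.
have eh : Ordinal k15 \in h15 k by rewrite mem_h15 //=; lia.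
split=> //.
  case: sk => [/lex_ltP[<- _]|[p /(Hpairs_top lk)[p1 p2 p12] ->]]; exact: card_face.
case: sk => [/lex_ltP[_ [m [ms mN mlt]]]|[p _ ->]]; last first.
  by exists (Ordinal k15); rewrite ?mem_face ?eh //=; lia.
have [mk|km] := ltnP m k; first by exists m.
by exists (Ordinal k15); rewrite -?mlt ?mem_face ?eh //=; lia.
Qed.

Lemma Delta15_complex : simplicial_complex Delta15.
Proof. by have [_ /(_ erefl)[]] := Delta15P rat Delta15. Qed.

Lemma mem_Delta15 s : (s \notin Delta15) <-> exists2 t, t \in gens15 & t \subset s.
Proof.
rewrite inE negbK; split=> [/existsP[t /andP[]]|[t tG ts]]; first by exists t.
by apply/existsP; exists t; rewrite tG.
Qed.

(** Outside the interval of the [face k a b], the complexes met during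
    combinatorial shifting do not change in cardinality [k + 2]. *)
Definition framed k (D : {set {set 'I_15}}) : Prop :=
  (forall s, high k s -> s \notin D) /\ (forall s, low k s -> s \in D).

Lemma Delta15_framed k : level k -> framed k Delta15.
Proof.
move=> lk; split=> s.
  move=> hs; apply/mem_Delta15; exists s => //; apply/mem_gens15; right.
  by exists k => //; left.
move=> ls; apply/negPn/negP => /mem_Delta15[t tG ts].
have [cs [m [mI mN mlt]]] := lex_ltP _ _ ls; rewrite card_face // in cs.
have [t9|[k' [lk' ct tk' [e et ek']]]] := gens15_small_element tG.
  by move: (subset_leq_card ts) lk; rewrite /level cs t9; lia.
have k'k : (k' <= k)%N by move: (subset_leq_card ts); rewrite cs ct.
move: k'k; rewrite leq_eqVlt => /predU1P[kE|k'k].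
  have /eqP ts' : t == s by rewrite eqEcard ts cs ct kE /=.
  rewrite {}kE {}ts' in tk'.
  case: tk' => [hs|[p /(Hpairs_top lk)[p1 p2 p12] sE]].
    by move: (lex_lt_trans hs ls); apply/negP; apply: face_not_high.
  by move: ls; rewrite sE; apply/negP/face_not_low.
have es := subsetP ts _ et.
have km : (k <= m.+1)%N.
  by move: mI; rewrite mem_face mem_h15 //= -!val_eqE /=; move: lk; rewrite /level; lia.
have : e \in face k v14 v15 by rewrite -mlt //; lia.
by rewrite mem_face mem_h15 // -!val_eqE /=; move: lk; rewrite /level; lia.
Qed.

Definition path_edge k (a b : 'I_15) : bool :=
  ((a, b) \in Hpairs k) || ((b, a) \in Hpairs k).

(** A generator inside [face k a b] cannot have a lower level, as it would
    have an element below [k]; so it is the face itself. *)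
Lemma Delta15_face k a b : level k -> top4 a -> top4 b -> a != b ->
  (face k a b \in Delta15) = ~~ path_edge k a b.
Proof.
move=> lk a4 b4 ab; apply: negb_inj; rewrite negbK; apply/idP/idP.
  move=> /mem_Delta15[t tG ts].
  have [t9|[k' [lk' ct tk' [e et ek']]]] := gens15_small_element tG.
    by move: (subset_leq_card ts); rewrite card_face // t9; move: lk; rewrite /level; lia.
  have es := subsetP ts _ et.
  have k'k : (k' = k).
    move: (subset_leq_card ts); rewrite ct card_face //.
    move: es; rewrite mem_face mem_h15 // -!val_eqE /=.
    by move: a4 b4 lk lk'; rewrite /top4 /level; lia.
  have /eqP tE : t == face k a b by rewrite eqEcard ts card_face // ct k'k /=.
  rewrite {}tE {}k'k in tk'.
  case: tk' => [|[p pH]]; first by rewrite (negPf (face_not_high _ _ _)).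
  have [p1 p2 p12] := Hpairs_top lk pH.
  move=> /(face_inj lk a4 b4 p1 p2)/setP e2.
  rewrite /path_edge; case: p {p1 p2} pH p12 e2 => c d /= pH cd e2.
  have := (e2 a, e2 b); rewrite !inE !eqxx orbT /= => -[].
  move=> /esym/orP[]/eqP ac /esym/orP[]/eqP bd; rewrite ac bd ?pH ?orbT //.
    by rewrite ac bd eqxx in ab.
  by rewrite ac bd eqxx in ab.
move=> e; apply/mem_Delta15; exists (face k a b) => //; apply/mem_gens15; right; exists k => //.
right; case/orP: e => pH; first by exists (a, b).
by exists (b, a); rewrite //= faceC.
Qed.

(** * Every combinatorial shifted complex contains a face on 13 and 14 *)

Section Dynamics.
Implicit Types (D : {set {set 'I_15}}) (a b c i j : 'I_15) (k : nat).

(** Shifting replaces [i] by [j > i], which lowers a set in the lexicographic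
    order; final segments of faces are therefore kept. *)
Lemma framed_shift k D i j : (i < j)%N -> framed k D -> framed k (shift D i j).
Proof.
move=> ij [hD lD]; split=> s; rewrite mem_shift //.
  move=> hs; rewrite (negPf (hD _ hs)) /=; case: ifP => //= si.
  case/boolP: (j \in s) => //= js; apply: hD.
  apply: lex_lt_trans hs _; rewrite -{1}(swapK js (negbT si)).
  apply: lex_lt_swap => //; rewrite !inE ?eqxx //= orbF.
  by apply: contraTneq ij => ->; rewrite ltnn.
move=> ls; rewrite (lD _ ls) /=; case: ifP => //= si.
case/boolP: (j \in s) => //= js; apply: lD.
exact: lex_lt_trans (lex_lt_swap ij si js) ls.
Qed.

Lemma shift_face_low k D i j a b : level k -> framed k D -> (i < j)%N -> (i < 11)%N ->
    top4 a -> top4 b -> a != b ->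
  (face k a b \in shift D i j) = (face k a b \in D).
Proof.
move=> lk [hD lD] ij i11 a4 b4 ab; rewrite mem_shift //.
case: ifP => iI; case/boolP: (j \in face k a b) => jI; rewrite ?andbT ?orbF //=.
  by rewrite (lD (j |: _)) ?andbT //; apply: low_swap.
by rewrite (negPf (hD (i |: _) _)) ?orbF //; apply: high_swap => //; rewrite iI.
Qed.

(** [mem_shift] for sets of size two: [m] is the graph of the pairs that are
    faces. The exchange of [i] and [j] is written out on each end of the pair,
    so that [m] is only evaluated at pairs of distinct vertices. *)
Definition pair_shift (m : 'I_15 -> 'I_15 -> bool) i j a b : bool :=
  if a == i then m a b && ((b == j) || m j b)
  else if b == i then m a b && ((a == j) || m a j)
  else if a == j then m a b || m i b
  else if b == j then m a b || m a i
  else m a b.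

Lemma shift_face_top k D i j a b : level k -> (i < j)%N -> top4 i ->
    top4 a -> top4 b -> a != b ->
  (face k a b \in shift D i j) = pair_shift (fun a b => face k a b \in D) i j a b.
Proof.
move=> lk ij i4 a4 b4 ab.
have j4 : top4 j by rewrite /top4 (leq_trans i4) // ltnW.
have nij : i == j = false by apply: contraTF ij => /eqP ->; rewrite ltnn.
have swapr x : x |: face k a b :\ b = face k a x.
  by rewrite faceC face_swap // 1?eq_sym // faceC.
rewrite mem_shift // /pair_shift !mem_face_top //.
rewrite (eq_sym i a) (eq_sym i b) (eq_sym j a) (eq_sym j b).
have swapl x : x |: face k a b :\ a = face k x b by apply: face_swap.
have [ai|ai] := eqVneq a i; first by move: swapl; rewrite ai nij => ->.
have [bi|bi] := eqVneq b i; first by move: swapr; rewrite bi nij orbF => ->.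
have [aj|aj] := eqVneq a j; first by move: swapl; rewrite aj => ->.
by have [bj|bj] := eqVneq b j; rewrite /= ?orbF //; move: swapr; rewrite bj => ->.
Qed.

Lemma eq_pair_shift m m' i j a b : (i < j)%N -> top4 i -> top4 a -> top4 b -> a != b ->
    (forall x y, top4 x -> top4 y -> x != y -> m x y = m' x y) ->
  pair_shift m i j a b = pair_shift m' i j a b.
Proof.
move=> ij i4 a4 b4 ab mm'; rewrite /pair_shift.
have j4 : top4 j by rewrite /top4 (leq_trans i4) // ltnW.
have [ai|ai] := eqVneq a i.
  by rewrite mm' //; have [//|bj] := eqVneq b j; rewrite mm' // eq_sym.
have [bi|bi] := eqVneq b i.
  by rewrite mm' //; have [//|aj] := eqVneq a j; rewrite mm'.
have [aj|aj] := eqVneq a j; first by rewrite !mm' // eq_sym.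
by have [bj|bj] := eqVneq b j; rewrite !mm'.
Qed.

(** The star is formed by the nonfaces: the pairs that contain [c]. *)
Definition star k c D : Prop := top4 c /\
  forall a b, top4 a -> top4 b -> a != b -> (face k a b \in D) = (c != a) && (c != b).

(** Nonfaces are moved from [j] to [i]: this moves the centre of the star if
    it is [j], and leaves the star in place otherwise. *)
Lemma star_shift k c D i j : level k -> (i < j)%N -> top4 i -> star k c D ->
  star k (if c == j then i else c) (shift D i j).
Proof.
move=> lk ij i4 [c4 cD]; split=> [|a b a4 b4 ab]; first by case: ifP.
rewrite shift_face_top // (eq_pair_shift ij i4 a4 b4 ab cD) /pair_shift.
have nij : i == j = false by apply: contraTF ij => /eqP ->; rewrite ltnn.
have nji : j == i = false by rewrite eq_sym.
have [cj|cj] := eqVneq c j.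
  rewrite cj; have [ai|ai] := eqVneq a i.
    by have [_|_] := eqVneq b j; rewrite ?eqxx ?andbF.
  have [bi|bi] := eqVneq b i.
    by have [_|_] := eqVneq a j; rewrite ?eqxx ?andbF.
  rewrite (eq_sym j a) (eq_sym j b) nji.
  have [aj|aj] := eqVneq a j; first by rewrite -aj eq_sym ab.
  by have [bj|bj] := eqVneq b j.
have [_|_] := eqVneq a i.
  by case: (b == j); case: (c == a); case: (c == b).
have [_|_] := eqVneq b i.
  by case: (a == j); case: (c == a); case: (c == b).
have [->|_] := eqVneq a j; first by rewrite (negPf cj); case: (c == b); rewrite ?andbF.
by have [->|_] := eqVneq b j; rewrite ?(negPf cj); case: (c == a).
Qed.

(** This is what the six paths are made for. Two edges of the path meet at
    [i], and the third one joins [j] to the vertex not adjacent to [i]: moved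
    from [j] to [i], it completes a star with centre [i]. *)
Lemma first_star i j : (i < j)%N -> top4 i -> exists2 k, level k &
  forall a b, top4 a -> top4 b -> a != b ->
    pair_shift (fun a b => ~~ path_edge k a b) i j a b = (i != a) && (i != b).
Proof.
move=> ij i4; have j4 : top4 j by rewrite /top4 (leq_trans i4) // ltnW.
pose k := match i : nat, j : nat with 11, 12 => 1 | 11, 13 => 2 | 11, 14 => 3
            | 12, 13 => 4 | 12, 14 => 5 | _, _ => 6 end.
exists k => [|a b a4 b4]; move: ij; rewrite /k.
  by case: (top4P i4) => ->; case: (top4P j4) => ->.
by case: (top4P i4) => ->; case: (top4P j4) => -> //= _; case: (top4P a4) => ->;
   case: (top4P b4) => ->.
Qed.

(** Along a sequence of shifts, the six graphs stay the initial paths until the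
    first pair inside the last four vertices, and from then on some level is
    a star. A shifted complex with the faces 12 13 or 12 14 of a level also
    has 13 14, which excludes the initial paths and settles the stars with
    centre 13 or 14. *)
Theorem combinatorial_shift_face Dc : combinatorial_shift Delta15 Dc ->
  exists2 k, level k & face k v13 v14 \in Dc.
Proof.
move=> [shDc [p [pP DcE]]].
pose paths D := forall k, level k -> forall a b, top4 a -> top4 b -> a != b ->
  (face k a b \in D) = ~~ path_edge k a b.
have [_ [paths_Dc|[k [c [lk [c4 cD]]]]]] :
    (forall k, level k -> framed k Dc) /\
    (paths Dc \/ exists k c, level k /\ star k c Dc).
- rewrite DcE; elim/last_ind: p pP {DcE} => [_|p [i j] IHp].
    by split; [exact: Delta15_framed|left=> k lk a b; exact: Delta15_face].
  rewrite all_rcons foldl_rcons /= => /andP[ij /IHp[frD stD]] {IHp}.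
  move: (foldl _ _ _) => D in frD stD *.
  split=> [k lk|]; first exact/framed_shift/frD.
  have [i11|i4] := ltnP i 11.
    case: stD => [pD|[k [c [lk [c4 cD]]]]].
      by left=> k lk a b a4 b4 ab; rewrite shift_face_low ?pD //; apply: frD.
    right; exists k, c; split=> //; split=> // a b a4 b4 ab.
    by rewrite shift_face_low ?cD //; apply: frD.
  right; case: stD => [pD|[k [c [lk cD]]]]; last first.
    by exists k, (if c == j then i else c); split=> //; apply: star_shift.
  have [k lk kP] := first_star ij i4; exists k, i; split=> //; split=> // a b a4 b4 ab.
  by rewrite shift_face_top // (eq_pair_shift ij i4 a4 b4 ab (pD k lk)) kP.
  (* at level 1 the pair 12 14 is a face, and shifting 12 to 13 gives 13 14 *)
- exists 1 => //; rewrite -(@face_swap 1 v12 v14 v13) //; apply: shDc => //.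
  + by rewrite paths_Dc.
  + by rewrite mem_face_top.
  + by rewrite mem_face_top.
have up x : x \in [:: v13; v14] -> face k v12 x \in Dc -> face k v13 v14 \in Dc.
  rewrite !inE => /orP[]/eqP -> fD.
    rewrite faceC -(@face_swap k v12 v13 v14) //.
    by apply: shDc => //; rewrite mem_face_top.
  by rewrite -(@face_swap k v12 v14 v13) //; apply: shDc => //; rewrite mem_face_top.
exists k => //; case: (top4P c4) => cE; rewrite cE in cD.
- by rewrite cD.
- by apply: (up v14) => //; rewrite cD.
- by apply: (up v13) => //; rewrite cD.
- by rewrite cD.
Qed.

End Dynamics.

Local Open Scope ring_scope.

(** * Linear substitutions in the exterior algebra *)

Section ExtCoef.
Variables (K : fieldType) (n : nat).
Implicit Types (s t u : {set 'I_n}) (f g : ext K n) (A B : 'M[K]_n) (l : seq 'I_n).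

Lemma ext_coefD f g t : (f + g) t = f t + g t :> K.
Proof. by rewrite ffunE. Qed.

Lemma ext_coefZ (c : K) f t : (c *: f) t = c * f t :> K.
Proof. by rewrite ffunE. Qed.

Lemma ext_coef_mono s t : mono K s t = (t == s)%:R :> K.
Proof. by rewrite ffunE. Qed.

Lemma ext_coef_sum (I : Type) (r : seq I) (P : pred I) (F : I -> ext K n) t :
  (\sum_(i <- r | P i) F i) t = \sum_(i <- r | P i) F i t :> K.
Proof. by rewrite sum_ffunE. Qed.

Lemma ext_coefM f g r :
  (f * g) r = \sum_s \sum_t f s * g t * wedge_mono K s t r :> K.
Proof.
rewrite -[f * g]/(wedge f g) /wedge ext_coef_sum; apply: eq_bigr => s _.
by rewrite ext_coef_sum; apply: eq_bigr => t _; rewrite ext_coefZ.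
Qed.

(** Unlike [mul_supp], this records that the supports do not overlap, which
    the counting of [gl_act_mono_supp] needs. *)
Lemma mul_supp_disj f g r : (f * g) r != 0 ->
  exists s t, [/\ f s != 0, g t != 0, [disjoint s & t] & s :|: t = r].
Proof.
rewrite ext_coefM => nz.
have [/existsP[s /existsP[t /and4P[fs gt d /eqP str]]]|] := boolP
  [exists s, [exists t, [&& f s != 0, g t != 0, [disjoint s & t] & s :|: t == r]]].
  by exists s, t.
rewrite negb_exists => /forallP nst; case/eqP: nz.
rewrite big1 // => s _; rewrite big1 // => t _.
have := nst s; rewrite negb_exists => /forallP/(_ t).
have [->|_] := eqVneq (f s) 0; first by rewrite !mul0r.
have [->|_] := eqVneq (g t) 0; first by rewrite mulr0 mul0r.
rewrite /wedge_mono; case: ifP => _ /=; last by rewrite ffunE mulr0.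
by move=> /negPf; rewrite ext_coefZ ext_coef_mono eq_sym => ->; rewrite !mulr0.
Qed.

Definition col_vec A (j : 'I_n) : ext K n := \sum_i A i j *: gen K i.

Lemma coef_col_vec A j t : col_vec A j t = \sum_i A i j * (t == [set i])%:R :> K.
Proof. by rewrite ext_coef_sum; apply: eq_bigr => i _; rewrite ext_coefZ ext_coef_mono. Qed.

Lemma col_vec_supp A j t : col_vec A j t != 0 -> exists2 i, t = [set i] & A i j != 0.
Proof.
rewrite coef_col_vec => nz.
have [/existsP[i /andP[/eqP -> Aij]]|] := boolP [exists i, (t == [set i]) && (A i j != 0)].
  by exists i.
rewrite negb_exists => /forallP ni; case/eqP: nz; rewrite big1 // => i _.
by move: (ni i); case: eqP => _; rewrite ?mulr0 //= negbK => /eqP ->; rewrite mul0r.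
Qed.

Lemma gl_act_linear A : linear (gl_act A).
Proof.
move=> c f g; rewrite /gl_act scaler_sumr -big_split; apply: eq_bigr => s _ /=.
by rewrite ext_coefD ext_coefZ scalerDl scalerA.
Qed.
HB.instance Definition _ A := GRing.isLinear.Build K (ext K n)
  (ext K n) *:%R (gl_act A) (gl_act_linear A).

Lemma gl_act_mono A s : gl_act A (mono K s) = \prod_(j <- enum s) col_vec A j.
Proof.
rewrite /gl_act (bigD1 s) //= ext_coef_mono eqxx scale1r [X in _ + X]big1 ?addr0 // => t nt.
by rewrite ext_coef_mono (negPf nt) scale0r.
Qed.

Lemma gl_act_gen A j : gl_act A (gen K j) = col_vec A j.
Proof. by rewrite gl_act_mono enum_set1 big_seq1. Qed.

Lemma gl_act1 A : gl_act A 1 = 1.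
Proof. by rewrite -[1 in LHS]/(mono K set0) gl_act_mono enum_set0 big_nil. Qed.

Definition alternating (w : 'I_n -> ext K n) : Prop :=
  (forall i, w i * w i = 0) /\ (forall i j, w i * w j = - (w j * w i)).

Lemma gen_alternating : alternating (@gen K n).
Proof. by split; [exact: gen_sq|exact: gen_anticomm]. Qed.

(** That the square of a vector vanishes has to be proved separately from
    anticommutation, because the characteristic may be 2. *)
Lemma col_vec_alternating A : alternating (col_vec A).
Proof.
split=> [j|j k].
  rewrite /col_vec big_distrlr /=.
  (* the products over i < i' cancel those over i' < i *)
  rewrite (eq_bigr (fun i => \sum_(i' < n) (A i j * A i' j) *: (gen K i * gen K i'))); last first.
    by move=> i _; apply: eq_bigr => i' _; rewrite -scalerAl -scalerAr scalerA.
  have split3 (i : 'I_n) : \sum_(i' < n) (A i j * A i' j) *: (gen K i * gen K i') =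
    \sum_(i' < n | (i' < i)%N) (A i j * A i' j) *: (gen K i * gen K i') +
    \sum_(i' < n | (i < i')%N) (A i j * A i' j) *: (gen K i * gen K i').
    rewrite (bigID (fun i' : 'I_n => (i' < i)%N)) /=; congr (_ + _).
    rewrite [in LHS](bigD1 i) ?ltnn //= gen_sq scaler0 add0r; apply: eq_bigl => i'.
    by rewrite -leqNgt ltn_neqAle eq_sym andbC.
  rewrite (eq_bigr _ (fun i _ => split3 i)) big_split /=.
  rewrite [X in X + _](exchange_big_dep xpredT) //= -big_split big1 // => i _ /=.
  rewrite -big_split big1 // => i' _ /=.
  by rewrite gen_anticomm scalerN mulrC addNr.
rewrite /col_vec !big_distrlr exchange_big /= -sumrN; apply: eq_bigr => i _.
rewrite -sumrN; apply: eq_bigr => i' _.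
by rewrite -!scalerAl -!scalerAr gen_anticomm !scalerN !scalerA mulrC.
Qed.

Definition increasing l := sorted (fun i j : 'I_n => (i < j)%N) l.

Lemma enum_increasing s : increasing (enum s).
Proof.
rewrite /increasing {1}/enum_mem; apply: sorted_filter.
  by move=> j i k; apply: ltn_trans.
by have := iota_ltn_sorted 0 n; rewrite -val_enum_ord sorted_map enumT.
Qed.

Lemma increasing_enum l : increasing l -> l = enum [set i in l].
Proof.
move=> srt; apply: (irr_sorted_eq _ _ srt (enum_increasing _)).
- by move=> j i k; apply: ltn_trans.
- by move=> i; rewrite /= ltnn.
- by move=> i; rewrite mem_enum inE.
Qed.

(** One step of insertion sort: [w j] is moved to its place, or meets itself
    and gives zero. The scalar does not depend on [w]. *)
Lemma insert_alternating j l : increasing l ->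
  exists (c : K) m, increasing m /\ {subset m <= j :: l} /\
    forall w, alternating w -> w j * \prod_(i <- l) w i = c *: \prod_(i <- m) w i.
Proof.
have tr : transitive (fun i j : 'I_n => (i < j)%N) by move=> b a c; apply: ltn_trans.
elim: l => [_|k l IHl srt].
  by exists 1, [:: j]; do 2!split=> //; move=> w _; rewrite big_nil big_seq1 mulr1 scale1r.
have srtl := path_sorted srt.
move: (srt); rewrite /increasing /= (path_sortedE tr) => /andP[/allP kl _].
case: (ltngtP j k) => [jk|kj|/val_inj jk].
- exists 1, (j :: k :: l); split; last by split=> // w _; rewrite scale1r [in RHS]big_cons.
  by rewrite /increasing /= jk.
- have [c [m [srtm [msub wm]]]] := IHl srtl; exists (- c), (k :: m); split; last split.
  + rewrite /increasing /= (path_sortedE tr) -/(increasing m) srtm andbT; apply/allP => i /msub.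
    by rewrite inE => /predU1P[->//|/kl].
  + move=> i; rewrite !inE => /predU1P[->|/msub]; first by rewrite eqxx orbT.
    by rewrite inE => /orP[]->; rewrite ?orbT.
  + move=> w wA; rewrite !big_cons mulrA (wA.2 j k) mulNr -mulrA wm //.
    by rewrite -scalerAr scaleNr.
- exists 0, [::]; do 2!split=> //; move=> w wA; rewrite scale0r big_cons mulrA jk wA.1.
  by rewrite mul0r.
Qed.

(** Reordering the factors of a product of vectors uses nothing but the
    alternating relations, so the sign it costs is the same for the basis
    vectors and for their images: this is why substituting new vectors for
    the [e_j] is compatible with products. *)
Lemma alternating_normal_form l :
  exists (c : K) s, forall w, alternating w ->
    \prod_(i <- l) w i = c *: \prod_(i <- enum s) w i.
Proof.
suff [c [m [srtm wm]]] : exists (c : K) m, increasing m /\ forall w, alternating w ->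
    \prod_(i <- l) w i = c *: \prod_(i <- m) w i.
  by exists c, [set i in m]; rewrite -increasing_enum.
elim: l => [|j l [c [m [srtm wm]]]].
  by exists 1, [::]; split=> // w _; rewrite scale1r.
have [c' [m' [srtm' [_ wm']]]] := insert_alternating j srtm.
exists (c * c'), m'; split=> // w wA.
by rewrite big_cons wm // -scalerAr wm' // scalerA.
Qed.

Lemma gl_act_prod_gen A l :
  gl_act A (\prod_(i <- l) gen K i) = \prod_(i <- l) col_vec A i.
Proof.
have [c [s wl]] := alternating_normal_form l.
rewrite (wl _ gen_alternating) (wl _ (col_vec_alternating A)).
by rewrite -mono_prod linearZ /= gl_act_mono.
Qed.

Lemma gl_actM A f g : gl_act A (f * g) = gl_act A f * gl_act A g.
Proof.
have monoM s t : gl_act A (mono K s * mono K t) =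
    gl_act A (mono K s) * gl_act A (mono K t).
  by rewrite !mono_prod -big_cat !gl_act_prod_gen big_cat.
rewrite (extE f) mulr_suml !linear_sum mulr_suml; apply: eq_bigr => s _.
rewrite -scalerAl !linearZ /= -scalerAl; congr (_ *: _ : ext K n).
rewrite (extE g) mulr_sumr !linear_sum mulr_sumr; apply: eq_bigr => t _.
by rewrite -scalerAr !linearZ /= -scalerAr monoM.
Qed.

Lemma gl_actE A f : gl_act A f = \sum_s f s *: gl_act A (mono K s).
Proof. by apply: eq_bigr => s _; rewrite gl_act_mono. Qed.

Lemma gl_act_comp A B f : gl_act A (gl_act B f) = gl_act (A *m B) f.
Proof.
rewrite (gl_actE B) (gl_actE (A *m B)) linear_sum /=; apply: eq_bigr => s _.
rewrite linearZ /=; congr (_ *: _ : ext K n).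
rewrite !gl_act_mono (big_morph _ (gl_actM A) (gl_act1 A)); apply: eq_bigr => j _.
rewrite /col_vec linear_sum /= (eq_bigr (fun i => \sum_k (A k i * B i j) *: gen K k)).
  by rewrite exchange_big; apply: eq_bigr => k _; rewrite -scaler_suml mxE.
move=> i _; rewrite linearZ /= gl_act_gen /col_vec scaler_sumr.
by apply: eq_bigr => k _; rewrite scalerA mulrC.
Qed.

Lemma gl_act_id f : gl_act 1%:M f = f.
Proof.
rewrite [RHS]extE; apply: eq_bigr => s _; congr (_ *: _ : ext K n).
rewrite mono_prod; apply: eq_bigr => j _.
rewrite (bigD1 j) //= mxE eqxx scale1r big1 ?addr0 // => i ij.
by rewrite mxE (negPf ij) scale0r.
Qed.

Lemma coef_gl_act A f t :
  gl_act A f t = \sum_s f s * gl_act A (mono K s) t :> K.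
Proof.
by rewrite gl_actE ext_coef_sum; apply: eq_bigr => s _; rewrite ext_coefZ.
Qed.

Lemma gl_act_supp A f t : gl_act A f t != 0 ->
  exists2 s, f s != 0 & gl_act A (mono K s) t != 0.
Proof.
rewrite coef_gl_act => nz.
have [/existsP[s /andP[fs As]]|] := boolP [exists s, (f s != 0) && (gl_act A (mono K s) t != 0)].
  by exists s.
rewrite negb_exists => /forallP ns; case/eqP: nz; rewrite big1 // => s _.
have := ns s; rewrite negb_and !negbK => /orP[]/eqP ->; first by rewrite mul0r.
exact: mulr0.
Qed.

(** Expanding the product of the columns indexed by [s] chooses in column [j]
    an index [i] with [A i j != 0], and distinct indices for distinct columns.
    If [A] cannot lead out of [P], there is at least one element of [P] chosen
    for each element of [s] in [P]. *)
Lemma gl_act_mono_supp A s t : gl_act A (mono K s) t != 0 ->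
  #|t| = #|s| /\
  forall P : pred 'I_n, (forall i j, A i j != 0 -> P j -> P i) ->
    (#|[set i in s | P i]| <= #|[set i in t | P i]|)%N.
Proof.
rewrite gl_act_mono => nz.
suff [-> Pt] : #|t| = size (enum s) /\
  forall P : pred 'I_n, (forall i j, A i j != 0 -> P j -> P i) ->
    (count P (enum s) <= #|[set i in t | P i]|)%N.
  split=> [|P /Pt]; first by rewrite -cardE.
  suff -> : count P (enum s) = #|[set i in s | P i]| by [].
  rewrite cardE -size_filter /enum_mem -!filter_predI; congr (size _).
  by apply: eq_filter => i; rewrite /= !inE andbC.
elim: (enum s) t nz => [|j l IHl] t; rewrite ?big_nil ?big_cons.
  rewrite -[1]/(mono K set0) ext_coef_mono; have [->|] := eqVneq t set0; last by rewrite eqxx.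
  by rewrite cards0.
case/mul_supp_disj => _ [t' [/col_vec_supp[i -> Aij] /IHl[ct' Pt'] d <-]].
split; first by rewrite cardsU (disjoint_setI0 d) cards0 subn0 cards1 ct'.
move=> P AP /=.
have -> : [set k in i |: t' | P k] = [set k in [set i] | P k] :|: [set k in t' | P k].
  by apply/setP => k; rewrite !inE andb_orl.
have dP : [set k in [set i] | P k] :&: [set k in t' | P k] = set0.
  apply/setP => k; rewrite !inE; apply/negP => /andP[/andP[/eqP-> _] /andP[it _]].
  by move: d; rewrite disjoints_subset sub1set inE it.
rewrite cardsU dP cards0 subn0; apply: leq_add; last exact: Pt'.
case Pj: (P j) => //; apply/card_gt0P; exists i.
by rewrite !inE eqxx (AP _ _ Aij Pj).
Qed.

End ExtCoef.

(** * Triangular substitutions and initial monomials *)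

(** By induction on the size, inverting a block triangular matrix blockwise. *)
Lemma trig_left_inverse (K : fieldType) n (L : 'M[K]_n) :
  is_trig_mx L -> L \in unitmx -> exists2 L', is_trig_mx L' & L' *m L = 1%:M.
Proof.
elim: n => [|n IHn] in L *.
  by move=> Ltr _; exists L => //; rewrite [LHS]flatmx0 [RHS]flatmx0.
suff inv (B : 'M[K]_(1 + n)) : is_trig_mx B -> B \in unitmx ->
  exists2 L', is_trig_mx L' & L' *m B = 1%:M by exact: inv.
rewrite -[B]submxK is_trig_block_mx // => /and3P[/eqP -> _ Dtr].
rewrite unitmxE det_lblock unitrM -!unitmxE => /andP[au /(IHn _ Dtr)[D' D'tr D'D]].
exists (block_mx (invmx (ulsubmx B)) 0 (- (D' *m dlsubmx B *m invmx (ulsubmx B))) D').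
  by rewrite is_trig_block_mx // eqxx mx11_is_trig.
have aV : invmx (ulsubmx B) *m ulsubmx B = 1%:M by exact: mulVmx.
rewrite mulmx_block !mul0mx !mulmx0 !addr0 add0r D'D mulNmx -!mulmxA aV.
by rewrite mulmx1 addNr; apply: esym (@scalar_mx_block _ 1 n 1).
Qed.

Section Triangular.
Variables (K : fieldType) (n : nat).
Implicit Types (s t u : {set 'I_n}) (f g : ext K n) (A L U : 'M[K]_n).

(** An upper triangular change of coordinates replaces [e_j] by combinations
    of the [e_i] with [i <= j]: for each [k] it cannot decrease the number of
    indices that are at most [k], so it moves monomials up. *)
Lemma upper_supp U s t : is_trig_mx U^T ->
  gl_act U (mono K s) t != 0 -> t = s \/ lex_lt s t.
Proof.
move=> /is_trig_mxP Utr /gl_act_mono_supp[c stP].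
have [->|nts] := eqVneq t s; first by left.
have [k [kst kmin]] := first_difference nts; right.
apply/lex_ltP; split=> //; exists k.
suff kt : k \in t.
  split=> // [|l /kmin->] //; by move: kst; rewrite kt; case: (k \in s).
have /stP : forall i j, U i j != 0 -> (j <= k)%N -> (i <= k)%N.
  move=> i j Uij jk; apply: contraNT Uij; rewrite -ltnNge => ki.
  by have := Utr j i (leq_ltn_trans jk ki); rewrite mxE => ->.
apply: contraLR => kt; have ks : k \in s by move: kst; rewrite (negPf kt); case: (k \in s).
rewrite -ltnNge; apply: proper_card; apply/properP; split.
  apply/subsetP => i; rewrite !inE leq_eqVlt => /andP[it /predU1P[/val_inj ik|ik]].
    by rewrite -ik it in kt.
  by rewrite -kmin // it ik orbT.
by exists k; rewrite !inE ?ks ?leqnn // (negPf kt).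
Qed.

Lemma lower_supp L s t : is_trig_mx L ->
  gl_act L (mono K s) t != 0 -> t = s \/ rev_lt t s.
Proof.
move=> /is_trig_mxP Ltr /gl_act_mono_supp[c stP].
have [->|nts] := eqVneq t s; first by left.
have [k [kst kmax]] := last_difference nts; right.
apply/rev_ltP; split=> //; exists k.
suff kt : k \in t by split=> //; move: kst; rewrite kt; case: (k \in s).
have /stP : forall i j, L i j != 0 -> (k <= j)%N -> (k <= i)%N.
  move=> i j Lij kj; apply: contraNT Lij; rewrite -ltnNge => ik.
  by rewrite (Ltr i j (leq_trans ik kj)).
apply: contraLR => kt; have ks : k \in s by move: kst; rewrite (negPf kt); case: (k \in s).
rewrite -ltnNge; apply: proper_card; apply/properP; split.
  apply/subsetP => i; rewrite !inE leq_eqVlt => /andP[it /predU1P[/val_inj ik|ik]].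
    by rewrite ik it in kt.
  by rewrite -kmax // it ik orbT.
by exists k; rewrite !inE ?ks ?leqnn // (negPf kt).
Qed.

(** A lower triangular [L] only adds smaller monomials in the reverse
    lexicographic order. If the initial monomial were cancelled, applying the
    inverse, also lower triangular, could not bring it back. *)
Lemma lower_initial L f s : is_trig_mx L -> L \in unitmx ->
  initial_mono f s -> initial_mono (gl_act L f) s.
Proof.
move=> Ltr /(trig_left_inverse Ltr)[L' L'tr L'L] [fs fmax].
have Lmax t : gl_act L f t != 0 -> t = s \/ rev_lt t s.
  case/gl_act_supp => u fu /(lower_supp Ltr) tu.
  have [us|/(fmax _ fu) us] := eqVneq u s; first by rewrite -us.
  by case: tu => [->|tu]; right=> //; apply: rev_lt_trans us.
split=> [|t /Lmax[->|//]]; last by rewrite eqxx.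
have: gl_act L' (gl_act L f) s != 0 by rewrite gl_act_comp L'L gl_act_id.
case/gl_act_supp => u Lu /(lower_supp L'tr)[su|su]; first by rewrite su.
have [us|us] := Lmax _ Lu; first by rewrite -{1}us.
by have := rev_lt_trans su us; rewrite rev_lt_irr.
Qed.

End Triangular.

(** * Polynomial functions on matrices and generic factorization *)

Section PolyFun.
Variable K : fieldType.

(** The functions whose nonvanishing defines basic open sets in the sense of
    [zariski_open_GL]. *)
Definition polyfun n (F : 'M[K]_n -> K) : Prop :=
  exists p : {mpoly K[n * n]}, forall A, F A = p.@[mxvec A 0].

Lemma polyfun_ext n (F G : 'M[K]_n -> K) : F =1 G -> polyfun F -> polyfun G.
Proof. by move=> FG [p pF]; exists p => A; rewrite -FG. Qed.

Lemma polyfun_const n c : polyfun (fun _ : 'M[K]_n => c).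
Proof. by exists c%:MP => A; rewrite mevalC. Qed.

Lemma polyfun_entry n i j : polyfun (fun A : 'M[K]_n => A i j).
Proof. by exists 'X_(mxvec_index i j) => A; rewrite mevalXU mxvecE. Qed.

Lemma polyfunD n (F G : 'M[K]_n -> K) :
  polyfun F -> polyfun G -> polyfun (fun A => F A + G A).
Proof. by move=> [p pF] [q qG]; exists (p + q) => A; rewrite mevalD pF qG. Qed.

Lemma polyfunM n (F G : 'M[K]_n -> K) :
  polyfun F -> polyfun G -> polyfun (fun A => F A * G A).
Proof. by move=> [p pF] [q qG]; exists (p * q) => A; rewrite mevalM pF qG. Qed.

Lemma polyfunB n (F G : 'M[K]_n -> K) :
  polyfun F -> polyfun G -> polyfun (fun A => F A - G A).
Proof. by move=> [p pF] [q qG]; exists (p - q) => A; rewrite mevalB pF qG. Qed.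

Lemma polyfun_sum n (I : Type) (r : seq I) (P : pred I) (F : I -> 'M[K]_n -> K) :
  (forall i, polyfun (F i)) -> polyfun (fun A => \sum_(i <- r | P i) F i A).
Proof.
move=> pF; elim: r => [|i r IHr].
  by apply: polyfun_ext (polyfun_const n 0) => A; rewrite big_nil.
case Pi: (P i).
  by apply: polyfun_ext (polyfunD (pF i) IHr) => A; rewrite big_cons Pi.
by apply: polyfun_ext IHr => A; rewrite big_cons Pi.
Qed.

Lemma polyfun_prod n (I : Type) (r : seq I) (P : pred I) (F : I -> 'M[K]_n -> K) :
  (forall i, polyfun (F i)) -> polyfun (fun A => \prod_(i <- r | P i) F i A).
Proof.
move=> pF; elim: r => [|i r IHr].
  by apply: polyfun_ext (polyfun_const n 1) => A; rewrite big_nil.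
case Pi: (P i).
  by apply: polyfun_ext (polyfunM (pF i) IHr) => A; rewrite big_cons Pi.
by apply: polyfun_ext IHr => A; rewrite big_cons Pi.
Qed.

Lemma polyfun_exp n (F : 'M[K]_n -> K) k : polyfun F -> polyfun (fun A => F A ^+ k).
Proof.
move=> pF; elim: k => [|k IHk]; first exact: polyfun_const.
by apply: polyfun_ext (polyfunM pF IHk) => A; rewrite exprS.
Qed.

Lemma polyfun_comp n m (G : 'M[K]_n -> 'M[K]_m) (F : 'M[K]_m -> K) :
  (forall i j, polyfun (fun A => G A i j)) -> polyfun F -> polyfun (fun A => F (G A)).
Proof.
move=> pG [p pF].
apply: (@polyfun_ext _ (fun A =>
  \sum_(k <- msupp p) p@_k * \prod_i mxvec (G A) 0 i ^+ k i)).
  by move=> A; rewrite pF mevalE.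
apply: polyfun_sum => k; apply: polyfunM; first exact: polyfun_const.
apply: polyfun_prod => i; apply: polyfun_exp.
by case/mxvec_indexP: i => i j; apply: polyfun_ext (pG i j) => A; rewrite mxvecE.
Qed.

Lemma polyfun_det n m (G : 'M[K]_n -> 'M[K]_m) :
  (forall i j, polyfun (fun A => G A i j)) -> polyfun (fun A => \det (G A)).
Proof.
move=> pG; apply: polyfun_sum => s; apply: polyfunM; first exact: polyfun_const.
by apply: polyfun_prod.
Qed.

Lemma polyfun_mul n (L : 'M[K]_n) (F : 'M[K]_n -> K) :
  polyfun F -> polyfun (fun A => F (L *m A)).
Proof.
apply: polyfun_comp => i j.
apply: (@polyfun_ext _ (fun A => \sum_k L i k * A k j)) => [A|]; first by rewrite mxE.
by apply: polyfun_sum => k; apply: polyfunM; [exact: polyfun_const|exact: polyfun_entry].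
Qed.

Lemma polyfun_gl_act n (f : ext K n) t : polyfun (fun A => gl_act A f t).
Proof.
apply: (@polyfun_ext _ (fun A => \sum_s f s * (\prod_(j <- enum s) col_vec A j) t)).
  by move=> A; rewrite coef_gl_act; apply: eq_bigr => s _; rewrite gl_act_mono.
apply: polyfun_sum => s; apply: polyfunM; first exact: polyfun_const.
elim: (enum s) t => [|j l IHl] t.
  by apply: polyfun_ext (polyfun_const n ((1 : ext K n) t)) => A; rewrite big_nil.
apply: (@polyfun_ext _ (fun A => \sum_u \sum_v
  col_vec A j u * (\prod_(i <- l) col_vec A i) v * wedge_mono K u v t)).
  by move=> A; rewrite big_cons ext_coefM.
apply: polyfun_sum => u; apply: polyfun_sum => v.
apply: polyfunM; last exact: polyfun_const.
apply: polyfunM; last exact: IHl.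
apply: (@polyfun_ext _ (fun A => \sum_i A i j * (u == [set i])%:R)).
  by move=> A; rewrite coef_col_vec.
by apply: polyfun_sum => i; apply: polyfunM; [exact: polyfun_entry|exact: polyfun_const].
Qed.

Lemma polyfun_line n (F : 'M[K]_n -> K) A B : polyfun F ->
  exists q : {poly K}, forall t, F (A + t *: (B - A)) = q.[t].
Proof.
move=> [p pF].
exists (\sum_(k <- msupp p) (p@_k)%:P *
  \prod_i ((mxvec A 0 i)%:P + (mxvec B 0 i - mxvec A 0 i) *: 'X) ^+ k i) => t.
rewrite pF mevalE horner_sum; apply: eq_bigr => k _.
rewrite hornerM hornerC horner_prod; congr (_ * _); apply: eq_bigr => i _.
rewrite horner_exp hornerD hornerC hornerZ hornerX linearD /= linearZ /= linearB /=.
by rewrite !mxE mulrC.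
Qed.

Hypothesis K_infinite : forall s : seq K, exists x : K, x \notin s.

(** A nonzero polynomial has fewer roots than an infinite field has
    elements. *)
Lemma poly_nonroot (q : {poly K}) : q != 0 -> exists t, q.[t] != 0.
Proof.
move=> q0; have [s us sz] : exists2 s : seq K, uniq s & size s = size q.
  elim: (size q) => [|N [s us sz]]; first by exists [::].
  have [x xs] := K_infinite s; exists (x :: s); rewrite /= ?xs ?us //.
  by rewrite sz.
have: ~~ all (root q) s.
  by apply/negP => rs; have := max_poly_roots q0 rs us; rewrite sz ltnn.
by case/allPn => t _ qt; exists t.
Qed.

(** Two nonempty Zariski open sets meet, already on the line that joins a
    point of the one to a point of the other. *)
Lemma polyfun_dense n (F G : 'M[K]_n -> K) A B : polyfun F -> polyfun G ->
  F A != 0 -> G B != 0 ->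
  exists t, F (A + t *: (B - A)) != 0 /\ G (A + t *: (B - A)) != 0.
Proof.
move=> pF pG FA GB.
have [p Fp] := polyfun_line A B pF; have [q Gq] := polyfun_line A B pG.
have p0 : p != 0.
  by apply: contraNneq FA => p0; have := Fp 0; rewrite scale0r addr0 p0 horner0 => ->.
have q0 : q != 0.
  apply: contraNneq GB => q0; have := Gq 1.
  by rewrite scale1r addrCA subrr addr0 q0 horner0 => ->.
have [t] := @poly_nonroot (p * q) (mulf_neq0 p0 q0).
by rewrite hornerM mulf_eq0 negb_or => /andP[pt qt]; exists t; rewrite Fp Gq.
Qed.

End PolyFun.

Section LU.
Variable K : fieldType.

Definition has_lu n (A : 'M[K]_n) : Prop := exists L U : 'M[K]_n,
  [/\ is_trig_mx L, is_trig_mx U^T & A = L *m U].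

(** Gaussian elimination without exchanging rows: it succeeds on the open set
    where the successive pivots do not vanish. The Schur complement is
    multiplied by the pivot to keep the conditions polynomial. *)
Lemma generic_lu n : exists F : 'M[K]_n -> K,
  [/\ polyfun F, F 1%:M != 0 & forall A, F A != 0 -> has_lu A].
Proof.
elim: n => [|n [F [pF F1 FLU]]].
  exists (fun _ => 1); split; [exact: polyfun_const|exact: oner_neq0|move=> A _].
  by exists 1%:M, 1%:M; split; rewrite ?flatmx0 //; apply/is_trig_mxP => -[].
pose pivot (A : 'M[K]_(1 + n)) := A 0 0.
pose schur (A : 'M[K]_(1 + n)) := pivot A *: drsubmx A - dlsubmx A *m ursubmx A.
exists (fun A : 'M_(1 + n) => pivot A * F (schur A)); split.
- apply: polyfunM; first exact: polyfun_entry.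
  apply: polyfun_comp pF => i j.
  apply: (@polyfun_ext _ _ (fun A : 'M[K]_(1 + n) =>
      A 0 0 * A (rshift 1 i) (rshift 1 j) -
      \sum_k A (rshift 1 i) (lshift n k) * A (lshift n k) (rshift 1 j))).
    by move=> A; rewrite !mxE; congr (_ - _); apply: eq_bigr => k _; rewrite !mxE.
  apply: polyfunB; first by apply: polyfunM; apply: polyfun_entry.
  by apply: polyfun_sum => k; apply: polyfunM; apply: polyfun_entry.
- have p1 : pivot 1%:M = 1 by rewrite /pivot mxE eqxx.
  rewrite p1 mul1r /schur p1 scale1r (@scalar_mx_block _ 1 n) block_mxKur.
  by rewrite block_mxKdl block_mxKdr mul0mx subr0.
suff lu (A : 'M_(1 + n)) : pivot A * F (schur A) != 0 -> has_lu A by exact: lu.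
rewrite mulf_eq0 negb_or => /andP[a0 /FLU[L [U [Ltr Utr SLU]]]].
pose a := pivot A.
have ulA : ulsubmx A = a%:M by 
  rewrite [LHS]mx11_scalar !mxE /a /pivot; congr (_ _ _)%:M; exact: val_inj.
exists (block_mx 1 0 (a^-1 *: dlsubmx A) L), (block_mx a%:M (ursubmx A) 0 (a^-1 *: U)); split.
- by rewrite is_trig_block_mx // eqxx mx11_is_trig.
- rewrite tr_block_mx trmx0 is_trig_block_mx // eqxx mx11_is_trig linearZ /=.
  apply/is_trig_mxP => i j ij; rewrite mxE; have /is_trig_mxP -> := Utr; by rewrite ?mulr0.
rewrite mulmx_block !mul1mx !mul0mx !mulmx0 !addr0 -[LHS]submxK ulA; congr block_mx.
  by rewrite mul_mx_scalar scalerA divff ?scale1r.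
rewrite -scalemxAr -SLU /schur -scalemxAl -scalerDr addrC subrK.
by rewrite scalerA mulVf ?scale1r.
Qed.

End LU.

(** * Generic ranks *)

Section GenericRank.
Variables (K : fieldType) (n : nat).

(** Both ranks are computed by kernels: adding the column [c] raises the rank
    exactly when it cuts down the left kernel of [M]. *)
Lemma rank_row_mx_neq m p (M : 'M[K]_(m, p)) (c : 'cV[K]_m) :
  (exists2 v : 'rV_m, v *m M = 0 & v *m c != 0) <->
  (\rank (row_mx M c) != \rank M)%N.
Proof.
have kMc (v : 'rV_m) : (v <= kermx (row_mx M c))%MS = (v *m M == 0) && (v *m c == 0).
  by rewrite sub_kermx mul_mx_row row_mx_eq0.
have sub : (kermx (row_mx M c) <= kermx M)%MS.
  by apply/row_subP => i; have := row_sub i (kermx (row_mx M c)); rewrite kMc sub_kermx => /andP[].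
have rk : (\rank (row_mx M c) == \rank M) = (kermx M <= kermx (row_mx M c))%MS.
  rewrite -(mxrank_leqif_sup sub) !mxrank_ker.
  apply/idP/idP => [/eqP->//|/eqP e]; apply/eqP.
  by rewrite -(subKn (rank_leq_row M)) -(subKn (rank_leq_row (row_mx M c))) e.
rewrite rk; split=> [[v vM vc]|/row_subPn[i]].
  apply: contra vc => ker_sub.
  have: (v <= kermx (row_mx M c))%MS by apply: submx_trans ker_sub; rewrite sub_kermx vM.
  by rewrite kMc => /andP[].
rewrite kMc => /nandP[|]; last by exists (row i (kermx M)) => //; rewrite -row_mul mulmx_ker row0.
by rewrite -row_mul mulmx_ker row0 eqxx.
Qed.

(** A matrix of maximal rank [r] has an invertible [r x r] submatrix, and
    the nonvanishing of the corresponding minor forces rank [r]. *)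
Lemma generic_rank m p (M : 'M[K]_n -> 'M[K]_(m, p)) :
    (forall i j, polyfun (fun A => M A i j)) ->
  exists F A0, [/\ polyfun F, F A0 != 0 &
    forall A B, F A != 0 -> F B != 0 -> \rank (M A) = \rank (M B)].
Proof.
move=> pM; have [A0 A0max] : exists A0, forall A, (\rank (M A) <= \rank (M A0))%N.
  suff: forall d A, (m <= \rank (M A) + d)%N ->
      exists A0, forall A, (\rank (M A) <= \rank (M A0))%N.
    by move/(_ m 0); apply; apply: leq_addl.
  elim=> [|d IHd] A mA.
    by exists A => B; apply: leq_trans (rank_leq_row _) _; rewrite addn0 in mA.
  case: (classic (exists B, \rank (M A) < \rank (M B))%N) => [[B AB]|max].
    by apply: (IHd B); apply: leq_trans mA _; rewrite addnS -addSn leq_add2r.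
  by exists A => B; rewrite leqNgt; apply/negP => AB; apply: max; exists B.
pose R := rowsub (maxrankfun (M A0)) (M A0).
have Rfull : row_full R^T by rewrite /row_full mxrank_tr -/(row_free R) maxrowsub_free.
pose f := maxrankfun (M A0); pose g := fullrankfun Rfull.
exists (fun A => \det (mxsub f g (M A))), A0; split.
- by apply: polyfun_det => i j; apply: polyfun_ext (pM (f i) (g j)) => A; rewrite mxE.
- rewrite -unitfE -unitmxE -unitmx_tr.
  suff -> : (mxsub f g (M A0))^T = rowsub g R^T by apply: fullrowsub_unit.
  by apply/matrixP => i j; rewrite !mxE.
suff rk A : \det (mxsub f g (M A)) != 0 -> \rank (M A) = \rank (M A0).
  by move=> A B /rk -> /rk ->.
rewrite -unitfE -unitmxE => /mxrank_unit rA; apply/eqP.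
rewrite eqn_leq A0max -{1}rA.
have -> : mxsub f g (M A) = rowsub f 1%:M *m M A *m colsub g 1%:M.
  by rewrite -mulmxA mulmx_colsub mulmx1 -rowsubE; apply/matrixP => i j; rewrite !mxE.
by apply: leq_trans (mxrankM_maxl _ _) (mxrankM_maxr _ _).
Qed.

End GenericRank.

(** * Generic initial ideals *)

Section Gin.
Variables (K : fieldType) (n : nat) (D : {set {set 'I_n}}).
Hypothesis D_complex : simplicial_complex D.
Implicit Types (s t x : {set 'I_n}) (f g : ext K n) (A : 'M[K]_n).

Lemma face_idealP f : face_ideal K D f <-> forall s, f s != 0 -> s \notin D.
Proof.
split=> [|fD].
  have [_ Ddown] := D_complex; move=> If.
  apply: (If (fun f => forall s, f s != 0 -> s \notin D)) => [|_ [s sD ->] t]; last first.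
    rewrite ext_coef_mono; have [->|] := eqVneq t s; last by rewrite eqxx.
    by rewrite inE in sD.
  split=> [s|g h Ig Ih s|g h Ih s|g h Ig s].
  - by rewrite ffunE eqxx.
  - rewrite ext_coefD; have [->|/Ig//] := eqVneq (g s) 0; rewrite add0r; exact: Ih.
  - move=> /mul_supp[u [v [_ /Ih vD <-]]]; apply: contra vD => /Ddown.
    by apply; apply: subsetUr.
  - move=> /mul_supp[u [v [/Ig uD _ <-]]]; apply: contra uD => /Ddown.
    by apply; apply: subsetUl.
rewrite (extE f); have [I0 ID IMl IMr] : is_ideal (face_ideal K D) by apply: ideal_genP.
elim/big_ind: _ => [//|g h|s _]; first exact: ID.
have [->|/fD sD] := eqVneq (f s) 0; first by rewrite scale0r.
have -> : f s *: mono K s = mono K s * ((f s : K) *: 1) by rewrite -scalerAr mulr1.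
apply: IMr; apply/mono_monomial_ideal.
by exists s; rewrite ?inE.
Qed.

Definition initial_of A s : Prop :=
  exists2 f, gl_image A (face_ideal K D) f & initial_mono f s.

(** The coordinates that have to vanish for [s] to be initial. *)
Definition not_below s t := [&& #|t| == #|s|, t != s & ~~ rev_lt t s].

(** The rows span the part of the image of the face ideal that has the degree
    of [s]; the other rows are set to zero so that all matrices have the same
    format. *)
Definition image_row A s x t : K :=
  if (x \notin D) && (#|x| == #|s|) then gl_act A (mono K x) t else 0.

Definition upper_coords s A : 'M_(#|{: {set 'I_n}}|, #|{: {set 'I_n}}|) :=
  \matrix_(i, j) if not_below s (enum_val j)
                 then image_row A s (enum_val i) (enum_val j) else 0.

Definition own_coords s A : 'cV_(#|{: {set 'I_n}}|) :=
  \col_i image_row A s (enum_val i) s.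

Lemma image_row_supp A s x t : image_row A s x t != 0 -> #|t| = #|s|.
Proof.
rewrite /image_row; case: ifP => [/andP[_ /eqP <-]|_]; last by rewrite eqxx.
by case/gl_act_mono_supp.
Qed.

(** An element with initial monomial [s] is a combination of the rows that is
    killed by [upper_coords] and not by [own_coords]. *)
Lemma initial_of_rank A s : initial_of A s <->
  \rank (row_mx (upper_coords s A) (own_coords s A)) != \rank (upper_coords s A).
Proof.
rewrite -rank_row_mx_neq.
pose comb (v : {set 'I_n} -> K) t := \sum_x v x * image_row A s x t.
have upE v i : ((\row_j v (enum_val j)) *m upper_coords s A) 0 i =
    if not_below s (enum_val i) then comb v (enum_val i) else 0.
  rewrite mxE (eq_bigr (fun j => v (enum_val j) * if not_below s (enum_val i)
    then image_row A s (enum_val j) (enum_val i) else 0)); last by move=> j _; rewrite !mxE.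
  rewrite -(big_enum_val (A := {: {set 'I_n}}) (fun x => v x * if not_below s (enum_val i)
    then image_row A s x (enum_val i) else 0)).
  by case: ifP => // _; rewrite big1 // => x _; rewrite mulr0.
have ownE v : (\row_j v (enum_val j)) *m own_coords s A = (comb v s)%:M.
  rewrite [LHS]mx11_scalar mxE; congr (_%:M).
  rewrite (eq_bigr (fun j => v (enum_val j) * image_row A s (enum_val j) s)).
    exact: esym (big_enum_val (A := {: {set 'I_n}}) (fun x => v x * image_row A s x s)).
  by move=> j _; rewrite !mxE.
split=> [[_ [g /face_idealP gD ->] [fs fmax]]|[v vup vown]].
  have combE t : #|t| = #|s| -> comb g t = gl_act A g t.
    move=> ts; rewrite coef_gl_act; apply: eq_bigr => x _; rewrite /image_row.
    have [->|/gD ->] := eqVneq (g x) 0; first by rewrite !mul0r.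
    case: eqP => //= xs; have [->//|/gl_act_mono_supp[]] := eqVneq (gl_act A (mono K x) t) 0.
    by rewrite ts => /esym/xs.
  exists (\row_j g (enum_val j)).
    apply/rowP => i; rewrite upE [RHS]mxE; case: ifP => // /and3P[/eqP ts tns tnlt].
    rewrite combE //; apply/eqP; apply: contraNT tnlt => ft; exact: fmax.
  rewrite ownE combE //; apply: contraNneq fs => /(congr1 (fun M : 'M_1 => M 0 0)).
  by rewrite !mxE eqxx mulr1n => ->.
pose w x := v 0 (enum_rank x).
have vE : v = \row_j w (enum_val j) by apply/rowP => j; rewrite mxE /w enum_valK.
pose g : ext K n := [ffun x => if (x \notin D) && (#|x| == #|s|) then w x else 0].
have combE t : comb w t = gl_act A g t.
  rewrite coef_gl_act; apply: eq_bigr => x _; rewrite /image_row ffunE.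
  by case: ifP; rewrite ?mul0r ?mulr0.
exists (gl_act A g).
  exists g => //; apply/face_idealP => x; rewrite ffunE.
  by case: ifP => [/andP[]//|_]; rewrite eqxx.
split=> [|t ft ts].
  by apply: contraNneq vown; rewrite vE ownE combE => ->; rewrite raddf0.
apply/negPn/negP => tlt; case/eqP: ft.
have [cts|/eqP cts] := eqVneq #|t| #|s|; last first.
  rewrite -combE /comb big1 // => x _.
  by have [->|/image_row_supp//] := eqVneq (image_row A s x t) 0; rewrite mulr0.
have := congr1 (fun M : 'rV_ _ => M 0 (enum_rank t)) vup.
by rewrite /= {1}vE upE enum_rankK mxE /not_below cts eqxx ts tlt combE.
Qed.

Hypothesis K_infinite : forall s : seq K, exists x : K, x \notin s.

(** [generic_rank] for the two matrices attached to each [s], on the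
    intersection of the finitely many open sets. *)
Lemma generic_initial_of : exists F A0, [/\ polyfun F, F A0 != 0 &
  forall A B, F A != 0 -> F B != 0 -> forall s, initial_of A s <-> initial_of B s].
Proof.
have pimage s x t : polyfun (fun A => image_row A s x t).
  rewrite /image_row; case: (_ && _); [exact: polyfun_gl_act|exact: polyfun_const].
have one s : exists F A0, [/\ polyfun F, F A0 != 0 &
  forall A B, F A != 0 -> F B != 0 -> initial_of A s <-> initial_of B s].
  have pup i j : polyfun (fun A => upper_coords s A i j).
    apply: (@polyfun_ext _ _ (fun A => if not_below s (enum_val j)
                 then image_row A s (enum_val i) (enum_val j) else 0)).
      by move=> A; rewrite mxE.
    by case: (not_below _ _); [exact: pimage|exact: polyfun_const].
  have [F [A [pF FA rkF]]] := generic_rank pup.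
  have [|G [B [pG GB rkG]]] := @generic_rank _ _ _ _
      (fun A => row_mx (upper_coords s A) (own_coords s A)).
    move=> i j; case: (split_ordP j) => k ->.
      by apply: polyfun_ext (pup i k) => C; rewrite row_mxEl.
    by apply: polyfun_ext (pimage s (enum_val i) s) => C; rewrite row_mxEr mxE.
  have [t [Ft Gt]] := polyfun_dense K_infinite pF pG FA GB.
  exists (fun C => F C * G C), (A + t *: (B - A)).
  split; [exact: polyfunM|exact: mulf_neq0|move=> C C'].
  rewrite !mulf_eq0 !negb_or => /andP[FC GC] /andP[FC' GC'].
  by rewrite !initial_of_rank (rkF C C') // (rkG C C').
suff all_s (l : seq {set 'I_n}) : exists F A0, [/\ polyfun F, F A0 != 0 &
    forall A B, F A != 0 -> F B != 0 -> forall s, s \in l -> initial_of A s <-> initial_of B s].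
  have [F [A [pF FA FP]]] := all_s (enum {: {set 'I_n}}); exists F, A; split=> // B C FB FC s.
  by apply: FP; rewrite ?mem_enum.
elim: l => [|s l [G [B [pG GB GP]]]].
  by exists (fun _ => 1), 0; split=> //; [exact: polyfun_const|exact: oner_neq0].
have [F [A [pF FA FP]]] := one s.
have [t [Ft Gt]] := polyfun_dense K_infinite pF pG FA GB.
exists (fun C => F C * G C), (A + t *: (B - A)).
split; [exact: polyfunM|exact: mulf_neq0|move=> C C'].
rewrite !mulf_eq0 !negb_or => /andP[FC GC] /andP[FC' GC'] u.
by rewrite inE => /predU1P[->|]; [exact: FP|exact: GP].
Qed.

Lemma initial_idealE A (G : {set {set 'I_n}}) f :
    (forall s, s \in G <-> initial_of A s) ->
  initial_ideal (gl_image A (face_ideal K D)) f <-> monomial_ideal K G f.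
Proof.
move=> GP; split=> If J idJ SJ; apply: If => //.
  by move=> _ [g [s [Ig gs ->]]]; apply: SJ; exists s => //; apply/GP; exists g.
by move=> _ [s /GP[g Ig gs] ->]; apply: SJ; exists g, s.
Qed.

(** The initial monomials are read off from the ranks of finitely many
    matrices whose entries are polynomials in the coordinate change. All these
    ranks are maximal on a nonempty open set, on which the initial ideal is
    therefore constant. *)
Theorem gin_exists : exists De, simplicial_complex De /\
  is_gin (face_ideal K D) (face_ideal K De).
Proof.
have [F [A0 [pF FA0 FP]]] := generic_initial_of.
pose G := [set s : {set 'I_n} | \rank (row_mx (upper_coords s A0) (own_coords s A0))
                   != \rank (upper_coords s A0)].
have GP s : s \in G <-> initial_of A0 s by rewrite inE initial_of_rank.
pose De := [set s : {set 'I_n} | ~~ [exists t : {set 'I_n} in G, t \subset s]].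
exists De; split; [split=> [j|s t]|].
- rewrite inE; apply/negP => /existsP[t /andP[/GP[_ [g /face_idealP gD ->] [ft _]] tj]].
  have [x /gD + /gl_act_mono_supp[tx _]] := gl_act_supp ft; case/negP.
  have [D1 Ddown] := D_complex.
  have: (#|x| <= 1)%N by rewrite -tx -(cards1 j) subset_leq_card.
  rewrite leq_eqVlt ltnS leqn0 => /orP[/cards1P[i ->] //|].
  by rewrite cards_eq0 => /eqP ->; apply: Ddown (D1 j) (sub0set _).
- rewrite !inE => /existsP sD ts; apply/existsP => -[u /andP[uG ut]]; apply: sD.
  by exists u; rewrite uG (subset_trans ut).
exists (fun A => A \in unitmx /\ F A != 0); split.
- have [p pE] := pF; exists (fun q => q = p) => A.
  by split=> -[Au]; [move=> FA; split=> //; exists p; rewrite -?pE|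
                     move=> [_ -> FA]; split=> //; rewrite pE].
- have det1 : \det (1%:M : 'M[K]_n) != 0 by rewrite det1 oner_neq0.
  have pdet : polyfun (fun A : 'M[K]_n => \det A).
    by apply: polyfun_det => i j; apply: polyfun_entry.
  have [t [dt Ft]] := polyfun_dense K_infinite pdet pF det1 FA0.
  by exists (1%:M + t *: (A0 - 1%:M)); rewrite unitmxE unitfE.
move=> A [_ FA] f; rewrite (@initial_idealE _ G); last first.
  by move=> s; rewrite GP; apply: FP.
split; apply: monomial_idealS => s; rewrite !inE.
  by move=> sG; exists s => //; rewrite !inE negbK; apply/existsP; exists s; rewrite inE sG /=.
by rewrite negbK => /existsP[t /andP[tG ts]]; exists t.
Qed.

End Gin.

Section GenericUpper.
Variables (K : fieldType) (n : nat).
Hypothesis K_infinite : forall s : seq K, exists x : K, x \notin s.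

(** A generic coordinate change is a product [L U], and [L] does not affect
    initial monomials: so an initial monomial attained at the generic upper
    triangular matrices belongs to the generic initial ideal. *)
Lemma generic_upper_gin (I G : ext K n -> Prop) (q : 'M[K]_n -> K) U0 s :
    is_gin I G -> polyfun q -> is_trig_mx U0^T -> q U0 != 0 ->
    (forall U, is_trig_mx U^T -> U \in unitmx -> q U != 0 ->
       exists2 f, gl_image U I f & initial_mono f s) ->
  G (mono K s).
Proof.
move=> [V [[P VP] [A1 /VP[A1u [p Pp pA1]]] VG]] pq U0tr qU0 qI.
have pp : polyfun (fun A => p.@[mxvec A 0]) by exists p.
have pdet : polyfun (fun A : 'M[K]_n => \det A).
  by apply: polyfun_det => i j; apply: polyfun_entry.
have [F [pF F1 FLU]] := generic_lu K n.
have pdetA1 : \det A1 * p.@[mxvec A1 0] != 0 by rewrite mulf_neq0 // -unitfE -unitmxE.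
have [t [/= + /FLU]] := polyfun_dense K_infinite (polyfunM pdet pp) pF pdetA1 F1.
move: (A1 + _) => A2 + [L [U2 [Ltr U2tr A2E]]]; rewrite A2E => pA2.
have pL : polyfun (fun U => \det (L *m U) * p.@[mxvec (L *m U) 0]).
  exact: (polyfun_mul L (polyfunM pdet pp)).
have [t' []] := polyfun_dense K_infinite pL pq pA2 qU0.
set U := U2 + _; rewrite /= mulf_eq0 negb_or => /andP[LUu pLU] qU.
rewrite -unitfE -unitmxE in LUu.
have [Lu Uu] : L \in unitmx /\ U \in unitmx by apply/andP; rewrite -unitmx_mul.
have Utr : is_trig_mx U^T.
  apply/is_trig_mxP => i j ij; have [/is_trig_mxP T2 /is_trig_mxP T0] := (U2tr, U0tr).
  by have := (T2 i j ij, T0 i j ij); rewrite !mxE => -[-> ->]; rewrite subrr mulr0 addr0.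
have [f [g Ig fE] fs] := qI U Utr Uu qU.
apply/(VG (L *m U)); first by apply/VP; split=> //; exists p.
move=> J idJ; apply; exists (gl_act L f), s; split=> //; last exact: lower_initial.
by exists g => //; rewrite fE gl_act_comp.
Qed.

End GenericUpper.

(** * The faces on 13 and 14 are lost by algebraic shifting *)

Section Witness.
Variable K : fieldType.
Implicit Types (k : nat) (U : 'M[K]_15) (a b c d i j : 'I_15).

Definition pface k (p : 'I_15 * 'I_15) := face k p.1 p.2.

(** The three largest pairs of 12, ..., 15 in the reverse lexicographic
    order. *)
Definition leading_pairs : seq ('I_15 * 'I_15) := [:: (v12, v13); (v12, v14); (v13, v14)].

Definition minor k U (r c : nat) : K :=
  gl_act U (mono K (pface k (nth (v12, v13) (Hpairs k) r)))
           (pface k (nth (v12, v13) leading_pairs c)).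

(** Expanded along the last column: the cofactors form the cross product of
    the first two columns, which [level_initial] uses as coefficients. *)
Definition det3 (M : nat -> nat -> K) : K :=
  M 0%N 2%N * (M 1%N 0%N * M 2%N 1%N - M 2%N 0%N * M 1%N 1%N) +
  M 1%N 2%N * (M 2%N 0%N * M 0%N 1%N - M 0%N 0%N * M 2%N 1%N) +
  M 2%N 2%N * (M 0%N 0%N * M 1%N 1%N - M 1%N 0%N * M 0%N 1%N).

Lemma polyfun_det3_minor k : polyfun (fun U => det3 (minor k U)).
Proof.
have pm (r c : nat) : polyfun (fun U => minor k U r c) by apply: polyfun_gl_act.
have pm2 (r c r' c' s d s' d' : nat) : polyfun (fun U =>
    minor k U r c * minor k U r' c' - minor k U s d * minor k U s' d').
  by apply: polyfunB; apply: polyfunM; apply: pm.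
apply: polyfunD; first apply: polyfunD; apply: polyfunM; try exact: pm; apply: pm2.
Qed.

(** The substitution that fixes [e_1, ..., e_14] and maps [e_15] to
    [e_12 + e_13 + e_14 + e_15]. *)
Definition shear : 'M[K]_15 :=
  \matrix_(i, j) ((i == j) || (j == v15) && top4 i)%:R.

Lemma shear_upper : is_trig_mx shear^T.
Proof.
apply/is_trig_mxP => i j ij; rewrite !mxE.
have [ji|_] := eqVneq j i; first by rewrite ji ltnn in ij.
case: eqP => // iv; move: ij; rewrite iv /=.
by rewrite ltnNge -ltnS ltn_ord.
Qed.

Lemma shear_col j : j != v15 -> col_vec shear j = gen K j.
Proof.
move=> jv; rewrite /col_vec (bigD1 j) //= mxE eqxx scale1r big1 ?addr0 // => i ij.
by rewrite mxE (negPf ij) (negPf jv) scale0r.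
Qed.

Lemma shear_col15 : col_vec shear v15 = gen K v12 + gen K v13 + gen K v14 + gen K v15.
Proof.
rewrite /col_vec.
rewrite (bigD1 v12) // (bigD1 v13) // (bigD1 v14) // (bigD1 v15) //= big1 ?addr0.
  by rewrite !mxE /= !scale1r !addrA.
move=> i /andP[/andP[/andP[i12 i13] i14] i15]; rewrite mxE (negPf i15) /=.
case/boolP: (top4 i) => [/top4P[]ie|_]; last by rewrite scale0r.
all: by rewrite ie eqxx in i12 i13 i14 i15.
Qed.

Lemma face_eq k a b c d : level k -> top4 a -> top4 b -> top4 c -> top4 d ->
  (a < b)%N -> (c < d)%N -> (face k a b == face k c d) = (a == c) && (b == d).
Proof.
move=> lk a4 b4 c4 d4 ab cd; apply/eqP/andP => [|[/eqP-> /eqP->]//].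
move=> /(face_inj lk a4 b4 c4 d4)/setP e; move: (e a) (e b); rewrite !inE !eqxx orbT /=.
move=> /esym/orP[/eqP ac|/eqP ad] /esym/orP[/eqP bc|/eqP bd].
- by move: ab; rewrite ac bc ltnn.
- by rewrite ac bd.
- by move: ab; rewrite ad bc => /(ltn_trans cd); rewrite ltnn.
- by move: ab; rewrite ad bd ltnn.
Qed.

Lemma shear_fix (s : {set 'I_15}) : v15 \notin s ->
  gl_act shear (mono K s) = mono K s.
Proof.
move=> s15; rewrite gl_act_mono mono_prod; apply: eq_big_seq => j; rewrite mem_enum => js.
by apply: shear_col; apply: contraTneq js => ->.
Qed.

Lemma shear_coef k a b c d : level k -> top4 a -> top4 b -> top4 c -> top4 d ->
  (a < b)%N -> (c < d)%N -> b != v15 ->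
  gl_act shear (mono K (face k a b)) (face k c d) = ((a == c) && (b == d))%:R :> K.
Proof.
move=> lk a4 b4 c4 d4 ab cd b15; rewrite shear_fix ?ext_coef_mono 1?eq_sym ?face_eq //.
rewrite mem_face_top // negb_or eq_sym [v15 == b]eq_sym b15 andbT -val_eqE /= neq_ltn.
by rewrite (leq_trans ab) // -ltnS ltn_ord.
Qed.

(** The shear replaces 15 in turn by 12, 13 and 14. To produce the face
    [{c, d}], the vertex [a] must be one of the two; the sign is negative when
    the new vertex has to pass [a]. *)
Lemma shear_coef15 k a c d : level k -> top4 a -> top4 c -> top4 d ->
  (a < v15)%N -> (c < d)%N -> (d < v15)%N ->
  gl_act shear (mono K (face k a v15)) (face k c d) = (a == c)%:R - (a == d)%:R :> K.
Proof.
move=> lk a4 c4 d4 a15 cd d15; pose s := h15 k :|: [set a].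
have sE i : s :|: [set i] = face k a i by rewrite /s /face -setUA.
have mem_s i : top4 i -> (i \in s) = (i == a).
  by move=> i4; rewrite !inE (negPf (h15_top lk i4)).
have invE i : top4 i -> inversions s [set i] = (i < a)%N.
  move=> i4; rewrite /inversions (bigD1 a) ?mem_s //= big_set1 big1 ?addn0 // => x.
  rewrite !inE => /andP[/orP[xh|/eqP->]]; last by rewrite eqxx.
  rewrite big_set1 => _; case: (ltnP i x) => // ix.
  have x4 : top4 x by rewrite /top4 (leq_trans i4) // ltnW.
  by move: (h15_top lk x4); rewrite xh.
have wE i : top4 i -> wedge_mono K s [set i] (face k c d) =
    ((a == c) && (i == d))%:R - ((a == d) && (i == c))%:R :> K.
  move=> i4; rewrite /wedge_mono disjoint_sym disjoints_subset sub1set inE mem_s //.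
  case: (ltngtP i a) => [ia|ai|/val_inj ia].
  - rewrite -val_eqE (ltn_eqF ia) /= ext_coefZ ext_coef_mono sE invE // ia expr1.
    rewrite eq_sym (faceC k a i) face_eq // mulN1r.
    have -> : (a == c) && (i == d) = false.
      by apply/negP => /andP[/eqP ac /eqP id]; move: ia; rewrite ac id => /(ltn_trans cd); rewrite ltnn.
    by rewrite sub0r andbC.
  - rewrite -val_eqE eq_sym (ltn_eqF ai) /= ext_coefZ ext_coef_mono sE invE //.
    rewrite ltnNge (ltnW ai) expr0 mul1r eq_sym face_eq //.
    have -> : (a == d) && (i == c) = false.
      by apply/negP => /andP[/eqP ad /eqP ic]; move: ai; rewrite ad ic => /(ltn_trans cd); rewrite ltnn.
    by rewrite subr0.
  - by rewrite ia eqxx /= ffunE andbC subrr.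
have -> : mono K (face k a v15) = mono K s * gen K v15.
  rewrite -[RHS]/(wedge _ _) wedge_monoE /wedge_mono disjoint_sym disjoints_subset.
  rewrite sub1set inE mem_s // sE invE //.
  have -> : v15 == a = false by rewrite eq_sym -val_eqE /= (ltn_eqF a15).
  by rewrite ltnNge (ltnW a15) expr0 scale1r.
rewrite gl_actM gl_act_gen shear_col15 shear_fix; last first.
  by rewrite mem_s // eq_sym -val_eqE /= (ltn_eqF a15).
rewrite !mulrDr !ext_coefD -![mono K s * gen K _]/(wedge (mono K s) (mono K _)).
rewrite !wedge_monoE !wE //.
move: cd d15 {wE}; case: (top4P c4) => ->; case: (top4P d4) => -> //= _ _;
  by rewrite ?andbF ?andbT ?subr0 ?sub0r ?addr0 ?add0r // addrC.
Qed.

(** The determinant is 1 or -1 for each of the six paths, so its square is 1;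
    no characteristic is excluded. *)
Lemma shear_det3 k : level k -> det3 (minor k shear) != 0.
Proof.
move=> lk; pose E (p t : 'I_15 * 'I_15) : K :=
  if p.2 == v15 then (p.1 == t.1)%:R - (p.1 == t.2)%:R else (p == t)%:R.
have mE (r c : nat) : (r < 3)%N -> (c < 3)%N -> minor k shear r c =
    E (nth (v12, v13) (Hpairs k) r) (nth (v12, v13) leading_pairs c).
  move=> r3 c3.
  have pH : nth (v12, v13) (Hpairs k) r \in Hpairs k.
    by apply: mem_nth; move/levelP: lk; rewrite !inE => /or4P[|||/or3P[]] /eqP ->.
  have tH : nth (v12, v13) leading_pairs c \in leading_pairs by apply: mem_nth.
  rewrite /minor; move: (nth _ _ r) (nth _ _ c) pH tH => [a b] [a' b'] pH.
  have [/= a4 b4 _] := Hpairs_top lk pH; have /= ab := Hpairs_lt lk pH.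
  rewrite !inE /pface /E /= => tH.
  have [a'4 b'4 a'b' b'15] : [/\ top4 a', top4 b', (a' < b')%N & (b' < v15)%N].
    by case/or3P: tH => /eqP[-> ->].
  have [b15|b15] := eqVneq b v15; last by rewrite shear_coef.
  by rewrite b15 shear_coef15 // -b15.
have sq : det3 (minor k shear) * det3 (minor k shear) = 1.
  rewrite /det3 !mE //; move/levelP: lk {mE}; rewrite !inE /E.
  by move=> /or4P[|||/or3P[]] /eqP -> /=; ring.
by apply: contra_eq_neq sq => ->; rewrite mul0r eq_sym oner_neq0.
Qed.

(** The cross product gives a combination of the images of the three monomials
    of the path without the coordinates 12 13 and 12 14, and with the
    determinant as coordinate at 13 14. Its terms in the initial segment are
    then subtracted: they lie in the image of the ideal, because [U] and its
    inverse preserve the span of that segment. *)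
Lemma level_initial k U : level k -> is_trig_mx U^T -> U \in unitmx ->
    det3 (minor k U) != 0 ->
  exists2 f, gl_image U (face_ideal K Delta15) f & initial_mono f (face k v13 v14).
Proof.
move=> lk Utr Uu dU.
pose p (r : nat) := nth (v12, v13) (Hpairs k) r.
have pH (r : nat) : (r < 3)%N -> p r \in Hpairs k.
  move=> r3; apply: mem_nth.
  by move/levelP: lk; rewrite !inE => /or4P[|||/or3P[]] /eqP ->.
pose m (r c : nat) := minor k U r c.
(* the cross product of the first two columns of the matrix of minors *)
pose c0 := m 1%N 0%N * m 2%N 1%N - m 2%N 0%N * m 1%N 1%N.
pose c1 := m 2%N 0%N * m 0%N 1%N - m 0%N 0%N * m 2%N 1%N.
pose c2 := m 0%N 0%N * m 1%N 1%N - m 1%N 0%N * m 0%N 1%N.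
pose x (r : nat) := mono K (pface k (p r)).
pose g0 := c0 *: x 0%N + c1 *: x 1%N + c2 *: x 2%N.
have f0E t : gl_act U g0 t = c0 * gl_act U (x 0%N) t + c1 * gl_act U (x 1%N) t + c2 * gl_act U (x 2%N) t :> K.
  by rewrite !linearD !linearZ /= !ext_coefD !ext_coefZ.
(* the terms of [g0] transformed by [U] that lie in the initial segment *)
pose h : ext K 15 := [ffun t => if high k t then gl_act U g0 t else 0].
have [V Vtr VUt] : exists2 V, is_trig_mx V & V *m U^T = 1%:M.
  by apply: trig_left_inverse; rewrite ?unitmx_tr.
have UV : U *m V^T = 1%:M by rewrite -[U]trmxK -trmx_mul VUt trmx1.
have crossE (y : K) t (j : nat) : (forall r, gl_act U (x r) t = m r j) ->
    c0 * m 0%N j + c1 * m 1%N j + c2 * m 2%N j = y -> gl_act U g0 t = y :> K.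
  by move=> xE <-; rewrite f0E !xE.
have coef12 : gl_act U g0 (face k v12 v13) = 0 :> K.
  by apply: (@crossE _ _ 0%N) => //; rewrite /c0 /c1 /c2; ring.
have coef13 : gl_act U g0 (face k v12 v14) = 0 :> K.
  by apply: (@crossE _ _ 1%N) => //; rewrite /c0 /c1 /c2; ring.
have coef23 : gl_act U g0 (face k v13 v14) = det3 (minor k U) :> K.
  by apply: (@crossE _ _ 2%N) => //; rewrite /det3 -!/(m _ _) /c0 /c1 /c2; ring.
have g0P s : g0 s != 0 -> exists2 r, (r < 3)%N & s = pface k (p r).
  rewrite !ext_coefD !ext_coefZ !ext_coef_mono => nz.
  have [->|s0] := eqVneq s (pface k (p 0%N)); first by exists 0%N.
  have [->|s1] := eqVneq s (pface k (p 1%N)); first by exists 1%N.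
  have [->|s2] := eqVneq s (pface k (p 2%N)); first by exists 2%N.
  by move: nz; rewrite (negPf s0) (negPf s1) (negPf s2) !mulr0 !addr0 eqxx.
have pP r : (r < 3)%N -> [/\ top4 (p r).1, top4 (p r).2 & (p r).1 != (p r).2].
  by move=> /pH; apply: Hpairs_top.
exists (gl_act U g0 - h).
  exists (g0 - gl_act V^T h); last by rewrite linearB /= gl_act_comp UV gl_act_id.
  apply/(face_idealP Delta15_complex) => s.
  have [hs _|hs] := boolP (high k s); first by have [+ _] := Delta15_framed lk; apply.
  have Vs : gl_act V^T h s = 0 :> K.
    apply/eqP; apply: contraNT hs => /gl_act_supp[u + /upper_supp].
    rewrite trmxK ffunE => + /(_ Vtr); case: ifP => [hu _|]; last by rewrite eqxx.
    by case=> [->//|]; apply: lex_lt_trans.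
  rewrite ext_coefD [X in _ + X]ffunE Vs oppr0 addr0 => /g0P[r r3 ->].
  have [p1 p2 p12] := pP r r3.
  by rewrite /pface Delta15_face // negbK /path_edge -surjective_pairing pH.
have fE t : (gl_act U g0 - h) t = if high k t then 0 else gl_act U g0 t :> K.
  rewrite ext_coefD [X in _ + X]ffunE [h t]ffunE.
  by case: ifP => _; rewrite ?subrr ?subr0.
split; first by rewrite fE (negPf (face_not_high _ _ _)) // coef23.
move=> t; rewrite fE; case: ifP => [_|tlow nz ts]; first by rewrite eqxx.
have [c [d [c4 d4 cd tE]]] : exists c d, [/\ top4 c, top4 d, c != d & t = face k c d].
  case/gl_act_supp: (nz) => u /g0P[r r3 ->] /(upper_supp Utr)[tp|].
    by have [p1 p2 p12] := pP r r3; exists (p r).1, (p r).2.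
  by have [p1 p2 p12] := pP r r3; case/(above_face lk p1 p2 p12) => //; rewrite tlow.
wlog lt_cd : c d c4 d4 cd tE / (c < d)%N.
  move=> W; have [|dc|/val_inj e] := ltngtP c d; first exact: W.
    by apply: (W d c) => //; [rewrite eq_sym|rewrite faceC].
  by rewrite e eqxx in cd.
(* a face with vertex 15 is smaller than the face 13 14; only 12 13 and 12 14
   are larger *)
have [d15|d15] := eqVneq d v15.
  apply/rev_ltP; rewrite tE d15 !card_face //; last by rewrite -d15.
  split=> //; exists v15; rewrite !mem_face_top //; split=> //; first by rewrite eqxx orbT.
  by move=> l; rewrite ltnNge -ltnS ltn_ord.
rewrite tE in nz ts; move: lt_cd d15 nz ts.
by case: (top4P c4) => ->; case: (top4P d4) => -> //= _ _; rewrite ?coef12 ?coef13 eqxx.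
Qed.

End Witness.

Theorem corollary4p4 (K : fieldType)
    (K_infinite : forall s : seq K, exists x : K, x \notin s) :
  ~ exists Dc : {set {set 'I_15}},
      combinatorial_shift Delta15 Dc /\ exterior_shift K Delta15 = Dc.
Proof.
have [De_complex De_gin] := epsilon_spec (inhabits set0) _ (gin_exists Delta15_complex K_infinite).
move=> [Dc [/combinatorial_shift_face[k lk kDc] DcE]].
have : face_ideal K Dc (mono K (face k v13 v14)).
  rewrite -DcE; apply: (generic_upper_gin K_infinite De_gin (polyfun_det3_minor K k)
    (shear_upper K) (shear_det3 K lk)) => U Utr Uu dU.
  exact: level_initial.
rewrite -DcE in kDc *; move/(face_idealP De_complex)/(_ (face k v13 v14)).
by rewrite ext_coef_mono eqxx oner_neq0 kDc => /(_ isT).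
Qed.
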